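(* Every algebraic link $K$ in a lens space $L_{p,q}$ is fibered, i.e. the complement $L_{p,q}\setminus K$ is the total space of a fiber bundle over $S^1$.
   Context: Let $p\ge 1$ and $q$ be coprime integers and let $\zeta\in\mathbb{C}$ be a primitive $p$-th root of unity. Write $S^3_\epsilon=\{(x,y)\in\mathbb{C}^2 : |x|^2+|y|^2=\epsilon^2\}$. The cyclic group $G_{p,q}=\langle\zeta\rangle\cong\mathbb{Z}_p$ acts freely on $S^3_\epsilon$ by $\zeta\cdot(x,y)=(\zeta x,\zeta^q y)$. The lens space is $L_{p,q}=S^3_\epsilon/G_{p,q}$ with quotient map $\pi$. The lift of a link in $L_{p,q}$ is its preimage under $\pi$. A polynomial $f(x,y)$ is $(p,q)$-invariant if there is an integer $0\le k<p$ with $f(\zeta x,\zeta^q y)=\zeta^k f(x,y)$ for all $(x,y)\in\mathbb{C}^2$. Polynomials are assumed non-constant, with $f(0,0)=0$, and either irreducible or a product of distinct irreducible polynomials. A link $K$ in $L_{p,q}$ is called algebraic if there exists a $(p,q)$-invariant polynomial $f$ such that the lift of $K$ in the 3-sphere is isotopic to the algebraic link $f^{-1}(0)\cap S^3_\epsilon$ for some $\epsilon>0$. Standing setting: $K$ is given by such an $f$, with lift $\widetilde{K}=f^{-1}(0)\cap S^3_\epsilon$, where $0<\epsilon\le\epsilon_0$ and $\epsilon_0>0$ is a number provided by Milnor's theorems, such that for $0<\epsilon\le\epsilon_0$ the map $f/|f|\colon S^3_\epsilon\setminus f^{-1}(0)\to S^1$ has no critical points and is a smooth fiber bundle. *)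

(* Defs.v *)
From HB Require Import structures.
From mathcomp Require Import all_boot all_order all_algebra generic_quotient.
From mathcomp Require Import complex.
From mathcomp Require Import all_classical all_reals all_analysis.

Set Implicit Arguments.
Unset Strict Implicit.
Unset Printing Implicit Defensive.

Import Order.TTheory GRing.Theory Num.Theory.
Import numFieldNormedType.Exports.

Local Open Scope classical_set_scope.
Local Open Scope ring_scope.
Local Open Scope complex_scope.

(** * Smooth maps *)

(* Meant for finite-dimensional [V] and [W], where differentiability together
   with continuity of all iterated directional derivatives is C^n. *)
Fixpoint Cn_on (R : realType) (V W : normedModType R) (n : nat)
    (U : set V) (g : V -> W) : Prop :=
  if n is n'.+1 then
    (forall x, U x -> differentiable g x) /\
    (forall v : V, Cn_on n' U (fun x => 'D_v g x))
  else forall x, U x -> {for x, continuous g}.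

(* Smooth maps out of an arbitrary subset [A] of a Euclidean space: locally
   restrictions of smooth maps defined on open sets. *)
Definition smooth_on (R : realType) (V W : normedModType R)
    (A : set V) (g : V -> W) : Prop :=
  forall x, A x -> exists (U : set V) (g' : V -> W),
    [/\ open U, U x, forall n, Cn_on n U g'
      & forall y, A y -> U y -> g y = g' y].

(** * Fibre bundles *)

(* [phi] restricted to [E] is a locally trivial bundle over [S]: over [S `&` U]
   the trivialisation is [x |-> (phi x, h x)], with inverse [k]. *)
Definition fiber_bundle (T B : topologicalType) (E : set T) (S : set B)
    (phi : T -> B) : Prop :=
  [/\ {within E, continuous phi}, phi @` E = S
    & exists F : topologicalType, forall b, S b ->
      exists (U : set B) (h : T -> F) (k : B * F -> T),
      [/\ open U, U b,
          {within E `&` phi @^-1` U, continuous h},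
          {within (S `&` U) `*` [set: F], continuous k}
        & (forall u y, S u -> U u ->
             [/\ E (k (u, y)), phi (k (u, y)) = u & h (k (u, y)) = y]) /\
          (forall x, E x -> U (phi x) -> k (phi x, h x) = x)]].

(* The smooth version for subsets of Euclidean spaces; by Whitney's theorem it
   is no restriction to take the fibre [F] inside some R^l. *)
Definition smooth_fiber_bundle (R : realType) (V W : normedModType R)
    (E : set V) (S : set W) (phi : V -> W) : Prop :=
  [/\ smooth_on E phi, phi @` E = S
    & exists (l : nat) (F : set 'rV[R]_l.+1), forall b, S b ->
      exists (U : set W) (h : V -> 'rV[R]_l.+1) (k : W * 'rV[R]_l.+1 -> V),
      [/\ open U, U b,
          smooth_on (E `&` phi @^-1` U) h,
          smooth_on ((S `&` U) `*` F) k
        & (forall u y, S u -> U u -> F y ->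
             [/\ E (k (u, y)), phi (k (u, y)) = u & h (k (u, y)) = y]) /\
          (forall x, E x -> U (phi x) -> F (h x) /\ k (phi x, h x) = x)]].

(** * The plane C^2 and its spheres *)

(* The plane R^2 carries the topology and the smooth structure of the complex
   numbers; algebra is done in [R[i]]. *)
Notation Cplane R := (R * R)%type (only parsing).
Notation C2 R := ((R * R) * (R * R))%type (only parsing).

Definition toC (R : realType) (a : Cplane R) : R[i] := a.1 +i* a.2.
Definition ofC (R : realType) (c : R[i]) : Cplane R :=
  (complex.Re c, complex.Im c).

Definition dotC (R : realType) (a b : Cplane R) : R := a.1 * b.1 + a.2 * b.2.
Definition dotC2 (R : realType) (z w : C2 R) : R :=
  dotC z.1 w.1 + dotC z.2 w.2.

Definition circle (R : realType) : set (Cplane R) := [set u | `|toC u| = 1].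

Definition sphere3 (R : realType) (eps : R) : set (C2 R) :=
  [set z | `|toC z.1| ^+ 2 + `|toC z.2| ^+ 2 = (eps ^+ 2)%:C].

(* Tangent spaces of the round spheres centred at 0. *)
Definition tangent_circle (R : realType) (u : Cplane R) : set (Cplane R) :=
  [set v | dotC u v = 0].
Definition tangent_sphere3 (R : realType) (z : C2 R) : set (C2 R) :=
  [set w | dotC2 z w = 0].

(** * Polynomials in x and y *)

Definition poly2 (R : realType) := {poly {poly R[i]}}.

Definition eval2 (R : realType) (f : poly2 R) (x y : R[i]) : R[i] := f.[x, y].

Definition irreducible_elt (A : idomainType) (a : A) : Prop :=
  [/\ a != 0, a \isn't a GRing.unit
    & forall b c : A, a = b * c -> b \is a GRing.unit \/ c \is a GRing.unit].

Definition associated (A : idomainType) (a b : A) : Prop :=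
  exists2 u : A, u \is a GRing.unit & a = u * b.

(* Irreducible, or a product of distinct irreducibles; "distinct" is read up to
   units, since otherwise [x * (2 x)] would qualify. *)
Definition reduced_product (A : idomainType) (a : A) : Prop :=
  exists s : seq A,
    [/\ forall b, b \in s -> irreducible_elt b,
        forall i j, (i < j < size s)%N -> ~ associated s`_i s`_j
      & a = \prod_(b <- s) b].

Definition admissible (R : realType) (f : poly2 R) : Prop :=
  [/\ forall c : R[i], f != c%:P%:P, eval2 f 0 0 = 0
    & reduced_product (f : {poly {poly R[i]}})].

Definition pq_invariant (R : realType) (p : nat) (q : int) (zeta : R[i])
    (f : poly2 R) : Prop :=
  exists2 k : nat, (k < p)%N &
    forall x y : R[i], eval2 f (zeta * x) (zeta ^ q * y) = zeta ^+ k * eval2 f x y.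

(** * Milnor fibrations *)

Definition polymap (R : realType) (f : poly2 R) (z : C2 R) : Cplane R :=
  ofC (eval2 f (toC z.1) (toC z.2)).

Definition zero_set (R : realType) (f : poly2 R) : set (C2 R) :=
  [set z | eval2 f (toC z.1) (toC z.2) = 0].

(* f / |f| *)
Definition milnor_map (R : realType) (f : poly2 R) (z : C2 R) : Cplane R :=
  ofC (eval2 f (toC z.1) (toC z.2) / `|eval2 f (toC z.1) (toC z.2)|).

(* The differential of f / |f| : S^3_eps \ f^-1(0) -> S^1 at [z] is not onto;
   here eps is the norm of [z]. *)
Definition milnor_critical (R : realType) (f : poly2 R) (z : C2 R) : Prop :=
  ~ (forall u, tangent_circle (milnor_map f z) u ->
       exists2 w, tangent_sphere3 z w & 'd (milnor_map f) z w = u).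

(* Transversality (Milnor, Corollary 2.9): 0 is a regular value of the
   restriction of f to S^3_eps, which is what makes f^-1(0) `&` S^3_eps a link. *)
Definition transverse_link (R : realType) (f : poly2 R) (eps : R) : Prop :=
  forall z, (sphere3 eps `&` zero_set f) z ->
    forall c : Cplane R, exists2 w, tangent_sphere3 z w & 'd (polymap f) z w = c.

(* The number eps0 of Milnor's theorems: for every eps <= eps0 the sphere cuts
   out a link, and f / |f| is a smooth fibration without critical points. *)
Definition milnor_radius (R : realType) (f : poly2 R) (eps0 : R) : Prop :=
  0 < eps0 /\ forall eps, 0 < eps -> eps <= eps0 ->
    [/\ transverse_link f eps,
        forall z, (sphere3 eps `\` zero_set f) z -> ~ milnor_critical f z
      & smooth_fiber_bundle (sphere3 eps `\` zero_set f) (@circle R)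
          (milnor_map f)].

(** * Lens spaces and their links *)

Section LensSpace.
Local Open Scope quotient_scope.
Variables (R : realType) (p : nat) (q : int) (zeta : R[i]) (eps : R).
Hypothesis hzeta : p.-primitive_root zeta.

(* [w = zeta^m . z] in C^2 for some group element zeta^m. *)
Definition lens_rel (z w : set_type (sphere3 eps)) : bool :=
  `[< exists m : int,
        toC (set_val w).1 = zeta ^ m * toC (set_val z).1 /\
        toC (set_val w).2 = (zeta ^ q) ^ m * toC (set_val z).2 >].

Lemma zeta_unit : zeta \is a GRing.unit.
Proof.
rewrite unitfE; apply/eqP => z0; have := prim_expr_order hzeta.
have p0 := prim_order_gt0 hzeta.
by rewrite z0 expr0n eqn0Ngt p0 => /esym/eqP; rewrite oner_eq0.
Qed.

Fact lens_rel_refl : reflexive lens_rel.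
Proof. by move=> z; apply/asboolP; exists 0; rewrite !expr0z !mul1r. Qed.

Fact lens_rel_sym : symmetric lens_rel.
Proof.
have aux z w : lens_rel z w -> lens_rel w z.
  move=> /asboolP[m [e1 e2]]; apply/asboolP; exists (- m); rewrite e1 e2 !mulrA.
  by rewrite -!expfzDr -?unitfE ?unitrXz ?zeta_unit// addNr !expr0z !mul1r.
by move=> z w; apply/idP/idP; exact: aux.
Qed.

Fact lens_rel_trans : transitive lens_rel.
Proof.
move=> w z v /asboolP[m [e1 e2]] /asboolP[n [e3 e4]]; apply/asboolP.
exists (n + m); rewrite e3 e4 e1 e2 !mulrA.
by rewrite -!expfzDr -?unitfE ?unitrXz ?zeta_unit.
Qed.

Definition lens_equiv : equiv_rel (set_type (sphere3 eps)) :=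
  EquivRel lens_rel lens_rel_refl lens_rel_sym lens_rel_trans.

Definition lens_space : topologicalType :=
  quotient_topology {eq_quot lens_equiv}.

Definition lens_proj (z : set_type (sphere3 eps)) : lens_space :=
  \pi_(quotient_topology {eq_quot lens_equiv}) z.

(* The preimage of [K] in S^3_eps, as a subset of C^2. *)
Definition link_lift (K : set lens_space) : set (C2 R) :=
  set_val @` (lens_proj @^-1` K).

(* The lift of [K] is the algebraic link of a (p,q)-invariant polynomial [f],
   taken on a sphere whose radius Milnor's theorems allow for [f]. *)
Definition algebraic_link (K : set lens_space) : Prop :=
  exists (f : poly2 R) (eps0 : R),
    [/\ admissible f, pq_invariant p q zeta f, milnor_radius f eps0,
        0 < eps <= eps0 & link_lift K = sphere3 eps `&` zero_set f].

Definition fibered_link (K : set lens_space) : Prop :=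
  exists phi : lens_space -> Cplane R, fiber_bundle (~` K) (@circle R) phi.

End LensSpace.

(* Main.v *)
(* Write g for the generator of the group. Since f(g z) = zeta^k f(z), the p-th
   power of the Milnor map f/|f| descends to the complement of K in the lens space.
   Local triviality does not descend formally, because the stabiliser of a fibre
   acts on that fibre; it comes from a flow on the sphere that commutes with g and
   turns the phase of f at unit speed, so that it descends to a flow transporting
   the fibres of the quotient map onto each other.

   With s = conj(y) f_x - conj(x) f_y, e = x f_x + y f_y and m = Re(e conj(f)), the
   field
     Y = i (f conj(s) conj(y) + |f|^2 m x, - f conj(s) conj(x) + |f|^2 m y)
   is tangent to the spheres, commutes with g and satisfies
     df(Y) = f (i D - m Im(e conj(f))),   D = |s|^2 + m^2.
   On the sphere D > 0: on the link by transversality, off the link because f/|f|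
   has no critical point. So the flow of Y/D exists for all time on the compact
   sphere, link included, and changes f by the factor e^(it) times a positive real.

   The flow is the limit of the Euler polygons (id + (t/2^n) X)^(2^n), which converge
   geometrically for a bounded Lipschitz field X; invariance, equivariance and the
   phase of f are read off the polygons. *)

From HB Require Import structures.
Require Import Defs.
From mathcomp Require Import all_boot all_order all_algebra generic_quotient ring lra.
From mathcomp Require Import complex.
From mathcomp Require Import all_classical all_reals all_analysis.

Set Implicit Arguments.
Unset Strict Implicit.
Unset Printing Implicit Defensive.

Import Order.TTheory GRing.Theory Num.Theory.
Import numFieldNormedType.Exports.

Local Open Scope classical_set_scope.
Local Open Scope ring_scope.
Local Open Scope complex_scope.

(** * Flows as limits of Euler polygons *)

(** Origin of Y: at a point z = (x, y) of the sphere the tangent space is the sum of the complex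
    line through n = (conj(y), - conj(x)) and the real line through iz, and df takes the value s on
    n and i e on iz. Y has the coefficient i f conj(s) on n and |f|^2 m on iz. These contribute i f
    |s|^2 and i f m (m + i Im(e conj(f))) to df(Y), so neither turns the phase of f backwards. Both
    are polynomials in x, y and their conjugates, whence the Lipschitz bounds and the extension over
    the link. The obstacle is that the complement of the link is not compact: a lift of the rotation
    field defined only there could run into the link in finite time. Here df(Y/D) = f (lambda + i)
    with lambda real and bounded on the sphere, so |f| changes at most exponentially and the zero
    set is neither reached nor left. Two consequences of the group law suffice: [Phi (- t)] inverts
    [Phi t], and [Phi t] is the [2 ^ n]-fold iterate of [Phi (t / 2 ^+ n)]. *)

Lemma eq_ler (R : numDomainType) (x y : R) : x = y -> x <= y.
Proof. by move->. Qed.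

Lemma natr_exp2 (R : realType) n : (2 ^ n)%:R = 2 ^+ n :> R.
Proof. by rewrite natrX. Qed.

Lemma exp2_neq0 (R : realType) n : 2 ^+ n != 0 :> R.
Proof. by rewrite expf_neq0. Qed.

Lemma exp2_gt0 (R : realType) n : 0 < 2 ^+ n :> R.
Proof. by rewrite exprn_gt0. Qed.

(* Completeness in a form that passes directly to products of normed modules. *)
Definition geometric_complete (R : realType) (V : normedModType R) : Prop :=
  forall (C : R) (u : nat -> V),
    (forall n, `|u n.+1 - u n| <= C / 2 ^+ n) ->
    exists l, forall n, `|l - u n| <= 2 * C / 2 ^+ n.

(** The intervals of radius [d n] about [u n] are nested because [d n = 2 * d n.+1]; the supremum of
    their left ends lies in all of them. *)
Lemma geometric_complete_real (R : realType) :
  geometric_complete (R : normedModType R).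
Proof.
move=> C u hu.
pose d n : R := 2 * C / 2 ^+ n.
have dS n : d n = 2 * d n.+1.
  by rewrite /d exprS; have := @exp2_neq0 R n => ?; field.
have hd n : `|u n.+1 - u n| <= d n.+1.
  by apply: le_trans (hu n) _; rewrite /d exprS; apply: eq_ler;
    have := @exp2_neq0 R n => ?; field.
have d0 n : 0 <= d n by rewrite dS mulr_ge0// (le_trans _ (hd n)).
have lo k n : u n - d n <= u (n + k)%N - d (n + k)%N.
  elim: k => [|k ih]; first by rewrite addn0.
  apply: (le_trans ih); rewrite addnS; have := hd (n + k)%N.
  by rewrite ler_norml (dS (n + k)%N) => /andP[]; lra.
have hi k n : u (n + k)%N + d (n + k)%N <= u n + d n.
  elim: k => [|k ih]; first by rewrite addn0.
  apply: le_trans ih; rewrite addnS; have := hd (n + k)%N.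
  by rewrite ler_norml (dS (n + k)%N) => /andP[]; lra.
have lohi m n : u m - d m <= u n + d n.
  have := lo n m; have := hi m n; rewrite addnC.
  by have := d0 (m + n)%N; lra.
pose A := range (fun n => u n - d n).
have ubA n : ubound A (u n + d n) by move=> _ [m _ <-].
exists (sup A) => n; rewrite ler_norml; apply/andP; split.
  rewrite lerBrDr addrC; apply: ub_le_sup; first by exists (u 0%N + d 0%N).
  by exists n.
rewrite lerBlDr addrC; apply: ge_sup; last exact: ubA.
by exists (u 0%N - d 0%N), 0%N.
Qed.

Lemma geometric_complete_prod (R : realType) (V W : normedModType R) :
  geometric_complete V -> geometric_complete W ->
  geometric_complete ((V * W)%type : normedModType R).
Proof.
move=> hV hW C u hu.
have [l1 h1] : exists l, forall n, `|l - (u n).1| <= 2 * C / 2 ^+ n.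
  by apply: hV => n; apply: le_trans (hu n); rewrite prod_normE le_max lexx.
have [l2 h2] : exists l, forall n, `|l - (u n).2| <= 2 * C / 2 ^+ n.
  by apply: hW => n; apply: le_trans (hu n); rewrite prod_normE le_max lexx orbT.
by exists (l1, l2) => n; rewrite prod_normE ge_max /= h1 h2.
Qed.

Section DiscreteGronwall.
Variables (R : realType).

(** Since [1 + a <= expR a], each of the [n] defects [b] is amplified by at most [expR (n%:R * a)].
    For 2^N steps, with [a] proportional to the step and [b] to its square, the bound is of order
    2^(-N). *)
Lemma gronwall_iter (a b : R) (e : nat -> R) (n : nat) :
  0 <= a -> 0 <= b -> e 0%N <= 0 ->
  (forall j, (j < n)%N -> e j.+1 <= (1 + a) * e j + b) ->
  e n <= n%:R * b * expR (n%:R * a).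
Proof.
move=> a0 b0 e0; elim: n => [|n ih] he; first by rewrite !mul0r.
have {}ih : e n <= n%:R * b * expR (n%:R * a).
  by apply: ih => j jn; apply: he; rewrite ltnW.
apply: le_trans (he n (ltnSn n)) _.
have E : 1 + a <= expR a by exact: expR_ge1Dx.
have a1 : 0 <= 1 + a by rewrite addr_ge0.
have -> : n.+1%:R * b * expR (n.+1%:R * a) =
    n%:R * b * expR (n%:R * a) * expR a + b * (expR (n%:R * a) * expR a).
  by rewrite -natr1 [in expR _]mulrDl mul1r expRD; ring.
apply: lerD.
  apply: le_trans (ler_wpM2l a1 ih) _.
  by rewrite mulrC -mulrA ler_wpM2l ?mulr_ge0// ler_wpM2l ?expR_ge0.
by rewrite -[leLHS]mulr1 ler_wpM2l// -expRD -expR0 ler_expR addr_ge0 ?mulr_ge0.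
Qed.

End DiscreteGronwall.

(** * Euler polygons of a bounded Lipschitz field and their limit flow *)

Section Euler.
Variables (R : realType) (V : normedModType R) (X : V -> V).

Definition euler (h : R) (x : V) : V := x + h *: X x.

(** The number of steps is a power of two, so that refining halves every step, and doubling the time
    while passing to level [n.+1] keeps the step. *)
Definition euler_iter (n : nat) (t : R) : V -> V :=
  iter (2 ^ n) (euler (t / 2 ^+ n)).

Lemma euler0 x : euler 0 x = x.
Proof. by rewrite /euler scale0r addr0. Qed.

Lemma euler_iter0n n x : euler_iter n 0 x = x.
Proof.
rewrite /euler_iter mul0r; elim: (2 ^ n)%N => //= k ->.
by rewrite euler0.
Qed.

Lemma euler_iter_double n t x :
  euler_iter n.+1 (2 * t) x = euler_iter n t (euler_iter n t x).
Proof.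
rewrite /euler_iter -iterD expnS mul2n -addnn.
suff -> : 2 * t / 2 ^+ n.+1 = t / 2 ^+ n by [].
by rewrite exprS; have := @exp2_neq0 R n => ?; field.
Qed.

Lemma euler_iter_inv (P : V -> V) n t x :
  (forall h y, P (euler h y) = euler h (P y)) ->
  P (euler_iter n t x) = euler_iter n t (P x).
Proof.
by move=> hP; rewrite /euler_iter; elim: (2 ^ n)%N => //= k ih; rewrite hP ih.
Qed.

Variables (M L : R).
Hypothesis M0 : 0 <= M.
Hypothesis L0 : 0 <= L.
Hypothesis Xb : forall x, `|X x| <= M.
Hypothesis Xl : forall x y, `|X x - X y| <= L * `|x - y|.

Lemma euler_lip h x y :
  `|euler h x - euler h y| <= (1 + `|h| * L) * `|x - y|.
Proof.
rewrite /euler opprD addrACA -scalerBr mulrDl mul1r -mulrA.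
apply: le_trans (ler_normD _ _) _; rewrite normrZ lerD2l.
by rewrite ler_wpM2l.
Qed.

(** Telescoping: the error of each step is carried on by [F] alone, so [G] may be any map near [F],
    such as two half-steps. *)
Lemma iter_compare (a b : R) (F G : V -> V) n x y : 0 <= a -> 0 <= b ->
  (forall u v, `|F u - F v| <= (1 + a) * `|u - v|) ->
  (forall u, `|F u - G u| <= b) ->
  `|iter n F x - iter n G y| <= expR (n%:R * a) * (`|x - y| + n%:R * b).
Proof.
move=> a0 b0 hF hFG.
have a1 : 0 <= 1 + a by rewrite addr_ge0.
have E : 1 + a <= expR a by exact: expR_ge1Dx.
elim: n => [|n ih]; first by rewrite /= !mul0r expR0 addr0 mul1r.
rewrite !iterS -(subrKA (F (iter n G y))).
apply: le_trans (ler_normD _ _) _.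
have := le_trans (hF _ _) (ler_wpM2l a1 ih).
move=> h1; have h2 := hFG (iter n G y).
apply: le_trans (lerD h1 h2) _.
have -> : expR (n.+1%:R * a) * (`|x - y| + n.+1%:R * b) =
    expR a * (expR (n%:R * a) * (`|x - y| + n%:R * b))
    + expR (n%:R * a + a) * b.
  by rewrite -natr1 [(_ + 1) * a]mulrDl mul1r expRD; ring.
apply: lerD.
  by rewrite ler_wpM2r// mulr_ge0 ?expR_ge0// addr_ge0// mulr_ge0.
by rewrite -[leLHS]mul1r ler_wpM2r// -expR0 ler_expR addr_ge0// mulr_ge0.
Qed.

Lemma step_total n (t : R) : 2 ^+ n * `|t / 2 ^+ n| = `|t|.
Proof.
by rewrite normrM normfV (ger0_norm (ltW (exp2_gt0 R n))) mulrCA mulfV ?mulr1.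
Qed.

Lemma euler_iter_compare n t s x y :
  `|euler_iter n t x - euler_iter n s y|
    <= expR (`|t| * L) * (`|x - y| + M * `|t - s|).
Proof.
have := @iter_compare (`|t / 2 ^+ n| * L) (`|t / 2 ^+ n - s / 2 ^+ n| * M)
  (euler (t / 2 ^+ n)) (euler (s / 2 ^+ n)) (2 ^ n) x y.
rewrite natr_exp2 !mulrA -mulrBl !step_total [_ * M]mulrC; apply.
- exact: mulr_ge0.
- exact: mulr_ge0.
- exact: euler_lip.
- move=> u; rewrite /euler opprD addrACA subrr add0r -scalerBl -mulrBl normrZ.
  by rewrite ler_wpM2l.
Qed.

(** One step of length h and two half-steps differ only in the point where the second half evaluates
    the field, an error of at most [|h| ^+ 2 * L * M]; there are [2 ^ n] such steps. *)
Lemma euler_iter_step n t x :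
  `|euler_iter n.+1 t x - euler_iter n t x|
    <= t ^+ 2 * L * M * expR (`|t| * L) / 2 ^+ n.
Proof.
rewrite distrC.
have -> : euler_iter n.+1 t x =
    iter (2 ^ n) (iter 2 (euler (t / 2 ^+ n.+1))) x.
  by rewrite -iterM mulnC -expnS.
have := @iter_compare (`|t / 2 ^+ n| * L) (`|t / 2 ^+ n| ^+ 2 * L * M)
  (euler (t / 2 ^+ n)) (iter 2 (euler (t / 2 ^+ n.+1))) (2 ^ n) x x.
rewrite natr_exp2 subrr normr0 add0r !mulrA !step_total => hh.
suff -> : t ^+ 2 * L * M * expR (`|t| * L) / 2 ^+ n
  = expR (`|t| * L) * 2 ^+ n * `|t / 2 ^+ n| * `|t / 2 ^+ n| * L * M.
  apply: hh.
  - exact: mulr_ge0.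
  - by rewrite !mulr_ge0.
  - exact: euler_lip.
  move=> u; set h := t / 2 ^+ n; set h2 := t / 2 ^+ n.+1.
  have hh2 : h = h2 + h2.
    by rewrite /h /h2 exprS; have := @exp2_neq0 R n => ?; field.
  have -> : euler h u - iter 2 (euler h2) u = h2 *: (X u - X (euler h2 u)).
    rewrite /= /euler; set b := X (u + h2 *: X u); set a := h2 *: X u.
    rewrite scalerBr hh2 scalerDl -/a [u + (a + a)]addrA opprD addrA.
    by rewrite [_ + a - (u + a)]addrC addKr.
  rewrite normrZ.
  apply: le_trans (ler_wpM2l (normr_ge0 _) (Xl _ _)) _.
  rewrite distrC addrAC subrr add0r [`|_ *: X u|]normrZ.
  apply: (@le_trans _ _ (`|h2| * (L * (`|h2| * M)))).
    by rewrite ler_wpM2l// ler_wpM2l// ler_wpM2l.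
  rewrite (_ : `|h2| * _ = `|h2| ^+ 2 * L * M); last by ring.
  rewrite ler_wpM2r// ler_wpM2r// ler_pXn2r ?nnegrE//.
  by rewrite hh2 -mulr2n normrMn mulr2n lerDl.
rewrite -[t ^+ 2]real_normK ?num_real// normrM normfV.
rewrite (ger0_norm (ltW (exp2_gt0 R n))).
by have := @exp2_neq0 R n => ?; field.
Qed.

(** The last step forward and the first step back cancel up to [|h| ^+ 2 * L * M], the field being
    evaluated at points at most [|h| * M] apart; induction removes the pairs from the inside. *)
Lemma euler_iter_inverse n t x :
  `|euler_iter n (- t) (euler_iter n t x) - x|
    <= t ^+ 2 * L * M * expR (`|t| * L) / 2 ^+ n.
Proof.
set h := t / 2 ^+ n.
have hyp k : `|iter k (euler (- h)) (iter k (euler h) x) - x|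
    <= k%:R * (`|h| ^+ 2 * L * M) * expR (k%:R * (`|h| * L)).
  elim: k => [|k ih]; first by rewrite /= subrr normr0 !mul0r.
  rewrite iterSr [iter k.+1 (euler h) x]iterS.
  set y := iter k (euler h) x in ih *.
  rewrite -(subrKA (iter k (euler (- h)) y)).
  apply: le_trans (ler_normD _ _) _.
  have h1 : `|iter k (euler (- h)) (euler (- h) (euler h y))
      - iter k (euler (- h)) y|
      <= expR (k%:R * (`|h| * L)) * (`|h| ^+ 2 * L * M).
    apply: (@le_trans _ _ (expR (k%:R * (`|h| * L)) *
        (`|euler (- h) (euler h y) - y| + k%:R * 0))).
      apply: iter_compare; rewrite ?mulr_ge0//.
        by move=> u v; rewrite -[`|h|]normrN; exact: euler_lip.
      by move=> u; rewrite subrr normr0.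
    rewrite mulr0 addr0 ler_wpM2l ?expR_ge0//.
    have -> : euler (- h) (euler h y) - y = h *: (X y - X (euler h y)).
      rewrite /euler scaleNr scalerBr; set a := h *: X y.
      by rewrite addrAC [y + a]addrC addrK.
    rewrite normrZ distrC.
    apply: le_trans (ler_wpM2l (normr_ge0 _) (Xl _ _)) _.
    rewrite addrAC subrr add0r [`|_ *: X y|]normrZ.
    apply: (@le_trans _ _ (`|h| * (L * (`|h| * M)))); last by apply: eq_ler; ring.
    by rewrite ler_wpM2l// ler_wpM2l// ler_wpM2l.
  apply: le_trans (lerD h1 ih) _.
  rewrite -natr1 (_ : expR _ * _ + _ =
    (k%:R + 1) * (`|h| ^+ 2 * L * M) * expR (k%:R * (`|h| * L))); last by ring.
  rewrite ler_wpM2l ?mulr_ge0 ?addr_ge0 ?exprn_ge0//.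
  by rewrite ler_expR ler_wpM2r ?mulr_ge0// lerDl.
have := hyp (2 ^ n)%N; rewrite natr_exp2 !mulrA step_total -mulNr.
move=> /le_trans; apply; apply: eq_ler.
rewrite -[t ^+ 2]real_normK ?num_real// normrM normfV.
rewrite (ger0_norm (ltW (exp2_gt0 R n))).
by have := @exp2_neq0 R n => ?; field.
Qed.

(** The field is frozen at [x], from which the polygon strays by at most [|t| * M]. The bound is
    uniform in [n], so it passes to the limit flow. *)
Lemma euler_iter_first_order n t x :
  `|euler_iter n t x - x - t *: X x| <= t ^+ 2 * L * M.
Proof.
set h := t / 2 ^+ n.
have h0 k : `|iter k (euler h) x - x| <= k%:R * `|h| * M.
  elim: k => [|k ih]; first by rewrite /= subrr normr0 !mul0r.
  rewrite iterS {1}/euler addrAC; apply: le_trans (ler_normD _ _) _.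
  by rewrite -natr1 !mulrDl mul1r; apply: lerD => //; rewrite normrZ ler_wpM2l.
have h1 k : (k <= 2 ^ n)%N ->
    `|iter k (euler h) x - x - (k%:R * h) *: X x| <= k%:R * `|h| * (`|t| * L * M).
  elim: k => [|k ih] kn; first by rewrite /= subrr mul0r scale0r subrr normr0 !mul0r.
  have -> : iter k.+1 (euler h) x - x - (k.+1%:R * h) *: X x =
      (iter k (euler h) x - x - (k%:R * h) *: X x)
      + h *: (X (iter k (euler h) x) - X x).
    rewrite iterS {1}/euler -natr1 mulrDl mul1r scalerDl scalerBr !opprD !addrA.
    by rewrite [_ + h *: _ - x]addrAC [_ + h *: _ - _]addrAC.
  apply: le_trans (ler_normD _ _) _.
  rewrite -natr1 !mulrDl mul1r; apply: lerD; first by apply: ih; rewrite ltnW.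
  rewrite normrZ ler_wpM2l//; apply: le_trans (Xl _ _) _.
  apply: le_trans (ler_wpM2l L0 (h0 k)) _.
  rewrite [`|t| * L]mulrC mulrA -mulrA -(mulrA L) ler_wpM2l// ler_wpM2r//.
  rewrite -(step_total n t) ler_wpM2r// -natr_exp2 ler_nat; exact: ltnW.
have := h1 _ (leqnn _); rewrite natr_exp2 step_total.
rewrite (_ : 2 ^+ n * h = t); last by rewrite /h mulrCA mulfV ?mulr1// exp2_neq0.
move=> /le_trans; apply; apply: eq_ler.
by rewrite -[t ^+ 2]real_normK ?num_real//; ring.
Qed.

(** The device for passing to the limit: an exact statement about the flow is proved up to
    [C / 2 ^+ n] with polygons of every level [n]. *)
Lemma ler_exp2_0 (a C : R) : (forall n : nat, a <= C / 2 ^+ n) -> a <= 0.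
Proof.
move=> h; rewrite leNgt; apply/negP => a0.
have C0 : 0 < C by have := h 0%N; rewrite expr0 divr1; exact: lt_le_trans.
have [n _ /(_ n (leqnn n))] := near_infty_natSinv_expn_lt (PosNum (divr_gt0 a0 C0)).
rewrite /= div1r ltr_pdivlMr// mulrC => /lt_le_trans /(_ (h n)).
by rewrite ltxx.
Qed.

Hypothesis Vc : geometric_complete V.

(** The rate [K t] does not depend on [x], which allows polygons that start at points of the flow
    itself, as in [flow_double]. *)
Lemma euler_flow : exists Phi : R -> V -> V, exists K : R -> R,
  forall t x n, `|Phi t x - euler_iter n t x| <= K t / 2 ^+ n.
Proof.
pose K t : R := 2 * (t ^+ 2 * L * M * expR (`|t| * L)).
have /choice[Phi hPhi] : forall tx : R * V, exists l, forall n,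
    `|l - euler_iter n tx.1 tx.2| <= K tx.1 / 2 ^+ n.
  by move=> [t x]; apply: Vc => n; exact: euler_iter_step.
by exists (fun t x => Phi (t, x)), K => t x n; exact: (hPhi (t, x)).
Qed.

Variables (Phi : R -> V -> V) (K : R -> R).
Hypothesis PhiE : forall t x n, `|Phi t x - euler_iter n t x| <= K t / 2 ^+ n.

Lemma flow_unique t x y (C : R) :
  (forall n, `|y - euler_iter n t x| <= C / 2 ^+ n) -> Phi t x = y.
Proof.
move=> h; apply/eqP; rewrite -subr_eq0 -normr_le0.
apply: (@ler_exp2_0 _ (K t + C)) => n.
rewrite -(subrKA (euler_iter n t x)) mulrDl; apply: le_trans (ler_normD _ _) _.
by apply: lerD => //; rewrite distrC.
Qed.

Lemma flow0 x : Phi 0 x = x.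
Proof.
by apply: (@flow_unique _ _ _ 0) => n; rewrite euler_iter0n subrr normr0 mul0r.
Qed.

Lemma flow_compare t s x y :
  `|Phi t x - Phi s y| <= expR (`|t| * L) * (`|x - y| + M * `|t - s|).
Proof.
rewrite -subr_le0; apply: (@ler_exp2_0 _ (K t + K s)) => n.
rewrite lerBlDr mulrDl.
have -> : Phi t x - Phi s y = (Phi t x - euler_iter n t x)
  + (euler_iter n s y - Phi s y) + (euler_iter n t x - euler_iter n s y).
  by rewrite addrAC !subrKA.
apply: le_trans (ler_normD _ _) _; apply: lerD; last exact: euler_iter_compare.
apply: le_trans (ler_normD _ _) _; apply: lerD; first exact: PhiE.
by rewrite distrC.
Qed.

Lemma flow_first_order t x : `|Phi t x - x - t *: X x| <= t ^+ 2 * L * M.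
Proof.
rewrite -subr_le0; apply: (@ler_exp2_0 _ (K t)) => n; rewrite lerBlDr.
have -> : Phi t x - x - t *: X x = (Phi t x - euler_iter n t x)
   + (euler_iter n t x - x - t *: X x) by rewrite -!addrA addKr.
apply: le_trans (ler_normD _ _) _.
by apply: lerD => //; exact: euler_iter_first_order.
Qed.

Lemma flow_double t x : Phi (2 * t) x = Phi t (Phi t x).
Proof.
apply/eqP; rewrite -subr_eq0 -normr_le0.
apply: (@ler_exp2_0 _ (K (2 * t) + (K t + expR (`|t| * L) * K t))) => n.
set z := euler_iter n t (Phi t x).
have -> : Phi (2 * t) x - Phi t (Phi t x) =
  (Phi (2 * t) x - euler_iter n.+1 (2 * t) x)
  + ((z - Phi t (Phi t x)) + (euler_iter n.+1 (2 * t) x - z)).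
  by rewrite [_ - _ + (_ - z)]addrC !addrA !subrK.
rewrite [leRHS]mulrDl; apply: le_trans (ler_normD _ _) _; apply: lerD.
  apply: le_trans (PhiE _ _ _) _.
  have K0 : 0 <= K (2 * t).
    have := le_trans (normr_ge0 _) (PhiE (2 * t) x 0).
    by rewrite expr0 divr1.
  rewrite ler_wpM2l// lef_pV2 ?posrE ?exp2_gt0//.
  by rewrite exprS ler_peMl ?ler1n// ltW// exp2_gt0.
rewrite [leRHS]mulrDl; apply: le_trans (ler_normD _ _) _; apply: lerD.
  by rewrite distrC; exact: PhiE.
rewrite euler_iter_double; apply: le_trans (euler_iter_compare _ _ _ _ _) _.
rewrite subrr normr0 mulr0 addr0 -mulrA ler_wpM2l ?expR_ge0// distrC.
exact: PhiE.
Qed.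

(** Cuts the exact flow into arbitrarily short pieces, on each of which an estimate of second order
    in time applies; [phase_line] adds these up. *)
Lemma flow_dyadic n t x : Phi t x = iter (2 ^ n) (Phi (t / 2 ^+ n)) x.
Proof.
elim: n t x => [|n ih] t x; first by rewrite expr0 divr1.
have -> : t = 2 * (t / 2) by rewrite mulrC divfK.
rewrite flow_double !(ih (t / 2)) -iterD expnS mul2n -addnn exprS.
suff -> : t / 2 / 2 ^+ n = 2 * (t / 2) / (2 * 2 ^+ n) by [].
by have := @exp2_neq0 R n => ?; field.
Qed.

Lemma flowNK t x : Phi (- t) (Phi t x) = x.
Proof.
apply/eqP; rewrite -subr_eq0 -normr_le0.
apply: (@ler_exp2_0 _ (K (- t) + (expR (`|- t| * L) * K t
  + t ^+ 2 * L * M * expR (`|t| * L)))) => n.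
set z := euler_iter n (- t) (Phi t x).
set w := euler_iter n (- t) (euler_iter n t x).
have -> : Phi (- t) (Phi t x) - x =
  (Phi (- t) (Phi t x) - z) + ((z - w) + (w - x)).
  by rewrite !addrA !subrK.
rewrite [leRHS]mulrDl; apply: le_trans (ler_normD _ _) _; apply: lerD; first exact: PhiE.
rewrite [leRHS]mulrDl; apply: le_trans (ler_normD _ _) _; apply: lerD; last first.
  exact: euler_iter_inverse.
apply: le_trans (euler_iter_compare _ _ _ _ _) _.
by rewrite subrr normr0 mulr0 addr0 -mulrA ler_wpM2l ?expR_ge0.
Qed.

(** [P] maps polygons exactly to polygons, and its Lipschitz bound carries the convergence
    across. *)
Lemma flow_commute (P : V -> V) (C : R) t x :
  (forall h y, P (euler h y) = euler h (P y)) ->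
  (forall y z, `|P y - P z| <= C * `|y - z|) ->
  P (Phi t x) = Phi t (P x).
Proof.
move=> hP hC; apply/esym/(@flow_unique _ _ _ (`|C| * K t)) => n.
rewrite -euler_iter_inv//; apply: le_trans (hC _ _) _.
rewrite -mulrA; apply: le_trans (ler_wpM2r (normr_ge0 _) (ler_norm C)) _.
by rewrite ler_wpM2l.
Qed.

Lemma flow_continuous : continuous (fun tx : R * V => Phi tx.1 tx.2).
Proof.
move=> [t x] /=; apply/cvgrPdist_lt => e e0.
pose C := expR (`|t| * L) * (1 + M).
have C0 : 0 < C by rewrite mulr_gt0 ?expR_gt0// ltr_pwDl.
exists (ball t (e / C), ball x (e / C)) => /=.
  by split; apply: nbhsx_ballx; rewrite divr_gt0.
move=> [s y] /= [ts xy]; apply: le_lt_trans (flow_compare _ _ _ _) _.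
move: ts xy; rewrite -!ball_normE /= => ts xy.
have Ce : C * (e / C) = e by rewrite mulrC divfK// gt_eqF.
rewrite -[ltRHS]Ce.
rewrite -mulrA ltr_pM2l ?expR_gt0// mulrDl mul1r.
by rewrite ltr_leD// ler_wpM2l// ltW.
Qed.

(** Polygons leave the level sets of [q], but only by [h ^+ 2 * B] per step, hence by
    [t ^+ 2 * B / 2 ^+ n] in all, which vanishes in the limit. *)
Lemma flow_invariant (q : V -> R) (B : R) t x : continuous q ->
  (forall h y, `|q (euler h y) - q y| <= h ^+ 2 * B) ->
  q (Phi t x) = q x.
Proof.
move=> cq hq.
have qn n : `|q (euler_iter n t x) - q x| <= t ^+ 2 * B / 2 ^+ n.
  have hk k : `|q (iter k (euler (t / 2 ^+ n)) x) - q x|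
      <= k%:R * ((t / 2 ^+ n) ^+ 2 * B).
    elim: k => [|k ih]; first by rewrite /= subrr normr0 mul0r.
    rewrite iterS -(subrKA (q (iter k (euler (t / 2 ^+ n)) x))).
    apply: le_trans (ler_normD _ _) _.
    by rewrite -(natr1 k) mulrDl mul1r addrC lerD.
  apply: le_trans (hk _) _; apply: eq_ler; rewrite natr_exp2.
  by have := @exp2_neq0 R n => ?; field.
have en : (fun n => euler_iter n t x) @ \oo --> Phi t x.
  apply/cvgrPdist_lt => e e0; have [K0|K0] := leP (K t) 0.
    near=> n; apply: le_lt_trans (PhiE _ _ _) _.
    by apply: le_lt_trans e0; rewrite mulr_le0_ge0// invr_ge0 ltW// exp2_gt0.
  near=> n; apply: le_lt_trans (PhiE _ _ _) _.
  rewrite mulrC -ltr_pdivlMr// -div1r; near: n.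
  exact: near_infty_natSinv_expn_lt (PosNum (divr_gt0 e0 K0)).
apply/eqP; rewrite -subr_eq0 -normr_le0 leNgt; apply/negP => d0.
set d := `|_| in d0.
have d2 : 0 < d / 2 by rewrite divr_gt0.
have B0 : 0 <= t ^+ 2 * B.
  by have := le_trans (normr_ge0 _) (qn 0%N); rewrite expr0 divr1.
have B1 : 0 < t ^+ 2 * B + 1 by rewrite ltr_wpDl.
have [n [n1 n2]] : exists n, `|q (Phi t x) - q (euler_iter n t x)| < d / 2
    /\ (t ^+ 2 * B + 1) / 2 ^+ n < d / 2.
  near \oo => n; exists n; split.
    near: n; have /cvgrPdist_lt := cvg_comp _ _ en (cq (Phi t x)).
    exact.
  rewrite mulrC -ltr_pdivlMr// -div1r; near: n.
  exact: near_infty_natSinv_expn_lt (PosNum (divr_gt0 d2 B1)).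
have := ler_normD (q (Phi t x) - q (euler_iter n t x))
  (q (euler_iter n t x) - q x).
rewrite subrKA -/d leNgt => /negP; apply.
have := qn n; have := exp2_gt0 R n => e0.
rewrite [ltRHS](splitr d) => h; apply: ltrD => //.
apply: le_lt_trans h (le_lt_trans _ n2).
by rewrite ler_wpM2r ?invr_ge0 ?(ltW e0)// lerDl.
Unshelve. all: by end_near. Qed.

End Euler.

(** * Fibre bundles from flows *)

Section Plane.
Variable R : realType.
Implicit Types (c d : R[i]) (u b : R * R).

Lemma toCK u : ofC (toC u) = u.
Proof. by case: u. Qed.

Lemma ofCK c : toC (ofC c) = c.
Proof. by case: c. Qed.

Lemma norm_eq1P c : `|c| = 1 <-> complex.Re c ^+ 2 + complex.Im c ^+ 2 = 1.
Proof.
rewrite normc_def; split=> [[h]|->]; last by rewrite sqrtr1.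
by rewrite -[LHS]sqr_sqrtr ?h ?expr1n// addr_ge0 ?sqr_ge0.
Qed.

Lemma circleP u : circle u <-> u.1 ^+ 2 + u.2 ^+ 2 = 1.
Proof. exact: norm_eq1P. Qed.

Definition cis (t : R) : R[i] := cos t +i* sin t.

Lemma cisD s t : cis (s + t) = cis s * cis t.
Proof. by rewrite /cis cosD sinD; simpc; congr (_ +i* _); ring. Qed.

Lemma cis0 : cis 0 = 1.
Proof. by rewrite /cis cos0 sin0. Qed.

Lemma norm_cis t : `|cis t| = 1.
Proof. by apply/norm_eq1P; rewrite /= cos2Dsin2. Qed.

Lemma cisXn t n : cis t ^+ n = cis (n%:R * t).
Proof.
elim: n => [|n ih]; first by rewrite expr0 mul0r cis0.
by rewrite exprS ih -cisD -natr1 mulrDl mul1r addrC.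
Qed.

Lemma circle_cis u : circle u -> exists t, u = ofC (cis t).
Proof.
move=> /circleP h.
have h1 : -1 <= u.1 <= 1.
  by rewrite -ler_norml -sqrtr_sqr -sqrtr1 ler_sqrt// -h lerDl sqr_ge0.
have h2 : sin (acos u.1) = `|u.2|.
  by rewrite sin_acos// -h addrC addKr sqrtr_sqr.
have [u0|u0] := leP 0 u.2.
  exists (acos u.1); rewrite /ofC /cis /= h2 ger0_norm// acosK//.
  by case: u {h h1 h2 u0}.
exists (- acos u.1); rewrite /ofC /cis /= cosN sinN h2 ltr0_norm// opprK acosK//.
by case: u {h h1 h2 u0}.
Qed.

(* The branch of the argument near [t]: [asin] is applied to the imaginary part
   of [u] rotated by [- t]. *)
Definition near_arg (t : R) u : R := t + asin (u.2 * cos t - u.1 * sin t).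

Definition half_plane (t : R) : set (R * R) :=
  [set u | 0 < u.1 * cos t + u.2 * sin t].

Lemma half_plane_center t : half_plane t (ofC (cis t)).
Proof. by rewrite /half_plane /= -!expr2 cos2Dsin2. Qed.

Lemma continuous_linear_plane (a b : R) :
  continuous (fun u : R * R => u.1 * a + u.2 * b).
Proof.
move=> u; apply: cvgD; (apply: cvgM; last exact: cvg_cst).
  exact: cvg_fst.
exact: cvg_snd.
Qed.

Lemma open_half_plane t : open (half_plane t).
Proof.
apply: (@open_comp _ _ (fun u : R * R => u.1 * cos t + u.2 * sin t)
  [set y | 0 < y]); last exact: open_gt.
by move=> u _; exact: continuous_linear_plane.
Qed.

Lemma rotated_sqr u t : circle u ->
  (u.1 * cos t + u.2 * sin t) ^+ 2 + (u.2 * cos t - u.1 * sin t) ^+ 2 = 1.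
Proof.
move=> /circleP h; rewrite -(mulr1 1) -{1}h -(cos2Dsin2 t); ring.
Qed.

Lemma half_plane_bound u t : circle u -> half_plane t u ->
  -1 < u.2 * cos t - u.1 * sin t < 1.
Proof.
move=> /(rotated_sqr t) h; rewrite /half_plane /= => h0.
have h1 : (u.2 * cos t - u.1 * sin t) ^+ 2 < 1.
  by rewrite -h ltrDr exprn_gt0.
rewrite -ltr_norml -(@ltr_pXn2r _ 2) ?nnegrE// expr1n.
by rewrite real_normK ?num_real.
Qed.

Lemma near_argK u t : circle u -> half_plane t u -> ofC (cis (near_arg t u)) = u.
Proof.
move=> hu hp; have hb := half_plane_bound hu hp.
have hb' : -1 <= u.2 * cos t - u.1 * sin t <= 1.
  by case/andP: hb => *; apply/andP; split; exact: ltW.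
have := rotated_sqr t hu; move: hp; rewrite /half_plane /=.
set a := _ + _; set b := u.2 * _ - _ => a0 ab.
have ca : cos (asin b) = a.
  by rewrite cos_asin// -ab addrK sqrtr_sqr gtr0_norm.
have sa : sin (asin b) = b by rewrite asinK.
rewrite /near_arg -/b cisD /cis ca sa /ofC /=; simpc => /=.
have := cos2Dsin2 t => cs; rewrite /a /b [RHS]surjective_pairing.
congr (_, _); first by rewrite -[RHS]mulr1 -cs; ring.
by rewrite -[RHS]mulr1 -cs; ring.
Qed.

Lemma near_arg_continuous u t : circle u -> half_plane t u ->
  {for u, continuous (near_arg t)}.
Proof.
move=> hu hp; apply: cvgD; first exact: cvg_cst.
have E : (fun v : R * R => v.2 * cos t - v.1 * sin t)
  = (fun v => v.1 * - sin t + v.2 * cos t).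
  by apply/funext => v; rewrite mulrN addrC.
apply: (cvg_comp (fun v : R * R => v.2 * cos t - v.1 * sin t) asin _
  (continuous_asin (half_plane_bound hu hp))).
suff : {for u, continuous (fun v : R * R => v.2 * cos t - v.1 * sin t)} by [].
by rewrite E; exact: continuous_linear_plane.
Qed.

End Plane.

(** The subtype carries the initial topology of [set_val], so convergence can be tested in [T]. *)
Lemma cvg_set_type (I : Type) (F : set_system I) (T : topologicalType)
    (A : set T) (g : I -> set_type A) (a : set_type A) {FF : Filter F} :
  set_val (g i) @[i --> F] --> set_val a -> g i @[i --> F] --> a.
Proof.
move=> h U [B [[W oW WB] Ba] BU].
have nW : nbhs (set_val a) W.
  by apply: open_nbhs_nbhs; split=> //; move: Ba; rewrite -WB.
have FW : F [set i | W (set_val (g i))] := h _ nW.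
by apply: (@filterS I F FF _ _ _ FW) => i Wi; apply: BU; move: Wi; rewrite -WB.
Qed.

Lemma set_val_continuous (T : topologicalType) (A : set T) :
  continuous (@set_val T A).
Proof. exact: initial_continuous. Qed.

(** The fibre is [A], the part of [E] over 1. Over a half-plane about [cis t] the argument has the
    continuous branch [near_arg t], and the flow for minus that time brings a point into [A]. The
    two trivialisation maps are inverse to each other because [Psi (- t)] inverts [Psi t]. *)
Lemma fiber_bundle_of_flow (R : realType) (T : topologicalType) (E : set T)
    (phi : T -> R * R) (Psi : R -> T -> T) :
  E !=set0 -> {within E, continuous phi} ->
  (forall x, E x -> circle (phi x)) ->
  continuous (fun tx : R * T => Psi tx.1 tx.2) ->
  (forall t x, E x -> E (Psi t x)) ->
  (forall t x, Psi (- t) (Psi t x) = x) ->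
  (forall t x, E x -> phi (Psi t x) = ofC (cis t * toC (phi x))) ->
  fiber_bundle E (@circle R) phi.
Proof.
move=> [x0 Ex0] cphi phiC cPsi PsiE PsiK phiPsi.
have PsiNK t x : Psi t (Psi (- t) x) = x by rewrite -{1}[t]opprK PsiK.
have toE x : E x -> exists t, phi x = ofC (cis t).
  by move=> Ex; exact/circle_cis/phiC.
pose A : set T := [set x | E x /\ phi x = ofC (cis 0)].
have Apsi t x : E x -> phi x = ofC (cis t) -> A (Psi (- t) x).
  move=> Ex xt; split; first exact: PsiE.
  by rewrite phiPsi// xt ofCK -cisD addNr.
have [t0 xt0] := toE _ Ex0.
have A0 : Psi (- t0) x0 \in A by apply/mem_set/Apsi.
(* A base point of the fibre, the default value of [insubd] off the domain of the trivialisation. *)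
pose a0 : set_type A := Sub (Psi (- t0) x0) A0.
split=> //.
  apply/seteqP; split=> [_ [x Ex <-]|u /circle_cis[t ->]]; first exact: phiC.
  exists (Psi t (Psi (- t0) x0)); first exact: (PsiE _ _ (PsiE _ _ Ex0)).
  have [E0 p0] := Apsi _ _ Ex0 xt0.
  by rewrite phiPsi// p0 ofCK -cisD addr0.
exists (set_type A) => b /circle_cis[t ->].
exists (half_plane t), (fun x => insubd a0 (Psi (- near_arg t (phi x)) x)),
  (fun uy => Psi (near_arg t uy.1) (set_val uy.2)).
have hA x : E x -> half_plane t (phi x) -> A (Psi (- near_arg t (phi x)) x).
  by move=> Ex hx; apply: Apsi => //; rewrite near_argK//; exact: phiC.
have hval x : E x -> half_plane t (phi x) ->
    set_val (insubd a0 (Psi (- near_arg t (phi x)) x))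
    = Psi (- near_arg t (phi x)) x.
  by move=> Ex hx; rewrite set_valE val_insubd mem_set//; exact: hA.
split.
- exact: open_half_plane.
- exact: half_plane_center.
- apply/subspace_continuousP => x [Ex hx].
  apply: cvg_set_type; rewrite hval//.
  have cx : phi y @[y --> within (E `&` phi @^-1` half_plane t) (nbhs x)]
      --> phi x.
    move/subspace_continuousP : cphi => /(_ x Ex) h.
    move=> P /h hP; apply: (@filterS _ (nbhs x) _ _ _ _ hP) => y Py [Ey _].
    exact: Py.
  have : (Psi (- near_arg t (phi y)) y)
      @[y --> within (E `&` phi @^-1` half_plane t) (nbhs x)]
      --> Psi (- near_arg t (phi x)) x.
    have c1 : - near_arg t (phi y)
        @[y --> within (E `&` phi @^-1` half_plane t) (nbhs x)]
        --> - near_arg t (phi x).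
      apply: cvgN; apply: cvg_comp cx _.
      exact: near_arg_continuous (phiC _ Ex) hx.
    have c2 : y @[y --> within (E `&` phi @^-1` half_plane t) (nbhs x)] --> x.
      exact: cvg_within.
    apply: (cvg_comp (fun y => (- near_arg t (phi y), y))
      (fun tx : R * T => Psi tx.1 tx.2) _ (cPsi (- near_arg t (phi x), x))).
    exact: (cvg_pair c1 c2).
  apply: cvg_trans; apply: near_eq_cvg.
  rewrite near_withinE; apply: filterE => y [Ey hy].
  by rewrite hval.
- apply/subspace_continuousP => -[u y] [[/= Cu hu] _].
  apply: cvg_within_filter.
  have c1 : near_arg t uy.1 @[uy --> nbhs (u, y)] --> near_arg t u.
    apply: (cvg_comp fst (near_arg t) cvg_fst).
    exact: near_arg_continuous.
  have c2 : set_val uy.2 @[uy --> nbhs (u, y)] --> set_val y.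
    apply: (cvg_comp snd _ cvg_snd); exact: set_val_continuous.
  apply: (cvg_comp (fun uy : (R * R) * set_type A =>
      (near_arg t uy.1, set_val uy.2))
      (fun tx : R * T => Psi tx.1 tx.2) _ (cPsi (near_arg t u, set_val y))).
  exact: (cvg_pair c1 c2).
- split=> [u y Cu hu|x Ex hx] /=.
    have [Ey py] : A (set_val y) by exact: set_valP.
    have Ep := PsiE (near_arg t u) _ Ey.
    have pE : phi (Psi (near_arg t u) (set_val y)) = u.
      by rewrite phiPsi// py ofCK -cisD addr0 near_argK.
    split=> //; apply: val_inj.
    by have := hval _ Ep; rewrite pE set_valE => ->//; rewrite PsiK.
  by rewrite hval// PsiNK.
Qed.

(** * Functions that are Lipschitz on balls, and polynomials *)

Section LocallyLipschitz.
Variables (R : realType) (V : normedModType R).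

(** Unlike global Lipschitz continuity, this is inherited by products, hence by polynomials. The
    global bounds that Euler polygons ask for come from a cutoff through
    [ball_lipschitz_support]. *)
Definition ball_lipschitz (W : normedModType R) (g : V -> W) : Prop :=
  forall r, exists2 C, 0 <= C &
    forall x y, `|x| <= r -> `|y| <= r -> `|g x - g y| <= C * `|x - y|.

Lemma ball_lipschitz_bounded (W : normedModType R) (g : V -> W) r :
  ball_lipschitz g -> exists2 C, 0 <= C & forall x, `|x| <= r -> `|g x| <= C.
Proof.
(* [r] may be negative, while the comparison with [g 0] needs 0 in the ball. *)
move=> /(_ `|r|)[C C0 h]; exists (`|g 0| + C * `|r|).
  by rewrite addr_ge0 ?mulr_ge0.
move=> x xr; have xr' : `|x| <= `|r| by apply: le_trans xr _; exact: ler_norm.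
have := h x 0 xr'; rewrite normr0 subr0 => /(_ (normr_ge0 _)) gx.
rewrite -{1}(subrK (g 0) (g x)) addrC; apply: le_trans (ler_normD _ _) _.
by rewrite lerD2l; apply: le_trans gx _; rewrite ler_wpM2l.
Qed.

Lemma ball_lipschitz_continuous (W : normedModType R) (g : V -> W) :
  ball_lipschitz g -> continuous g.
Proof.
move=> hg x; have [C C0 h] := hg (`|x| + 1); apply/cvgrPdist_lt => e e0.
have C1 : 0 < C + 1 by rewrite ltr_wpDl.
near=> y.
have xy1 : `|x - y| < 1.
  by near: y; apply: (@cvgr_dist_lt _ _ _ (nbhs x) _ id) => //; exact: cvg_id.
have xye : `|x - y| < e / (C + 1).
  near: y; apply: (@cvgr_dist_lt _ _ _ (nbhs x) _ id); first exact: cvg_id.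
  exact: divr_gt0.
have hy : `|y| <= `|x| + 1.
  rewrite -(subrK x y) addrC; apply: le_trans (ler_normD _ _) _.
  by rewrite lerD2l distrC ltW.
apply: le_lt_trans (h x y _ hy) _; first by rewrite lerDl.
move: xye; rewrite ltr_pdivlMr//; apply: le_lt_trans.
by rewrite mulrC ler_wpM2l// lerDl.
Unshelve. all: by end_near. Qed.

Lemma ball_lipschitz_cst (W : normedModType R) (c : W) :
  ball_lipschitz (fun=> c).
Proof. by move=> r; exists 0 => // x y _ _; rewrite subrr normr0 mul0r. Qed.

Lemma ball_lipschitz_comp (W W' : normedModType R) (K : R) (g : V -> W)
    (p : W -> W') : 0 <= K -> (forall a b, `|p a - p b| <= K * `|a - b|) ->
  ball_lipschitz g -> ball_lipschitz (fun x => p (g x)).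
Proof.
move=> K0 hp hg r; have [C C0 h] := hg r; exists (K * C); first exact: mulr_ge0.
move=> x y xr yr; apply: le_trans (hp _ _) _.
by rewrite -mulrA ler_wpM2l// h.
Qed.

Lemma ball_lipschitz_pair (W W' : normedModType R) (g : V -> W) (g' : V -> W') :
  ball_lipschitz g -> ball_lipschitz g' -> ball_lipschitz (fun x => (g x, g' x)).
Proof.
move=> hg hg' r; have [C C0 h] := hg r; have [C' C'0 h'] := hg' r.
exists (C + C'); first exact: addr_ge0.
move=> x y xr yr; rewrite prod_normE ge_max /=; apply/andP; split.
  by apply: le_trans (h _ _ xr yr) _; rewrite ler_wpM2r// lerDl.
by apply: le_trans (h' _ _ xr yr) _; rewrite ler_wpM2r// lerDr.
Qed.

Lemma ball_lipschitzD (W : normedModType R) (g g' : V -> W) :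
  ball_lipschitz g -> ball_lipschitz g' -> ball_lipschitz (fun x => g x + g' x).
Proof.
move=> hg hg' r; have [C C0 h] := hg r; have [C' C'0 h'] := hg' r.
exists (C + C'); first exact: addr_ge0.
move=> x y xr yr; rewrite opprD addrACA; apply: le_trans (ler_normD _ _) _.
by rewrite mulrDl lerD// ?h ?h'.
Qed.

Lemma ball_lipschitz_bilinear (W1 W2 W : normedModType R) (K : R)
    (b : W1 -> W2 -> W) (g1 : V -> W1) (g2 : V -> W2) : 0 <= K ->
  (forall u v, `|b u v| <= K * `|u| * `|v|) ->
  (forall u u' v v', b u v - b u' v' = b (u - u') v + b u' (v - v')) ->
  ball_lipschitz g1 -> ball_lipschitz g2 ->
  ball_lipschitz (fun x => b (g1 x) (g2 x)).
Proof.
move=> K0 hb hbB h1 h2 r.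
have [C1 C10 l1] := h1 r; have [C2 C20 l2] := h2 r.
have [B1 B10 b1] := ball_lipschitz_bounded r h1.
have [B2 B20 b2] := ball_lipschitz_bounded r h2.
exists (K * C1 * B2 + K * B1 * C2); first by rewrite addr_ge0 ?mulr_ge0.
move=> x y xr yr; rewrite hbB mulrDl; apply: le_trans (ler_normD _ _) _.
apply: lerD.
  apply: le_trans (hb _ _) _; rewrite -!mulrA ler_wpM2l// [B2 * _]mulrC mulrA.
  by apply: ler_pM => //; [exact: l1|exact: b2].
apply: le_trans (hb _ _) _; rewrite -!mulrA ler_wpM2l//.
by apply: ler_pM => //; [exact: b1|exact: l2].
Qed.

(* Points at distance at least 1 are handled by the bound. *)
Lemma ball_lipschitz_support (W : normedModType R) (g : V -> W) (r : R) :
  ball_lipschitz g -> (forall x, r < `|x| -> g x = 0) ->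
  exists M L, [/\ 0 <= M, 0 <= L, forall x, `|g x| <= M
    & forall x y, `|g x - g y| <= L * `|x - y|].
Proof.
move=> hg g0; have [L L0 hL] := hg (`|r| + 1).
have [M M0 hM] := ball_lipschitz_bounded (`|r| + 1) hg.
have gM x : `|g x| <= M.
  have [xr|xr] := leP `|x| (`|r| + 1); first exact: hM.
  rewrite g0 ?normr0//; apply: le_lt_trans (ler_norm r) _.
  by apply: le_lt_trans xr; rewrite lerDl.
exists M, (L + M); split=> //; first exact: addr_ge0.
have far x y : `|x| <= r -> `|r| + 1 < `|y| -> `|g x - g y| <= (L + M) * `|x - y|.
  move=> xr yr; rewrite (g0 y) ?subr0; last first.
    by apply: le_lt_trans (ler_norm r) _; apply: le_lt_trans yr; rewrite lerDl.
  apply: le_trans (gM x) _; have xy : 1 <= `|x - y|.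
    have := ler_normD (y - x) x; rewrite subrK distrC => h.
    have := le_trans xr (ler_norm r); move: yr h; lra.
  have : M * 1 <= M * `|x - y| by exact: ler_wpM2l.
  by rewrite mulr1 mulrDl => /le_trans; apply; rewrite lerDr mulr_ge0.
have near0 x y : `|x| <= r -> `|g x - g y| <= (L + M) * `|x - y|.
  move=> xr; have [yr|yr] := leP `|y| (`|r| + 1); last exact: far.
  have xr' : `|x| <= `|r| + 1.
    by apply: le_trans xr (le_trans (ler_norm r) _); rewrite lerDl.
  by apply: le_trans (hL _ _ xr' yr) _; rewrite ler_wpM2r// lerDl.
move=> x y; have [xr|xr] := leP `|x| r; first exact: near0.
have [yr|yr] := leP `|y| r; first by rewrite distrC (distrC x); exact: near0.
by rewrite !g0// subrr normr0 mulr_ge0// addr_ge0.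
Qed.

End LocallyLipschitz.

Section ComplexFunctions.
Variables (R : realType) (V : normedModType R).
Implicit Types (c d : R[i]) (f g : V -> R[i]).

Lemma ofCD c d : ofC (c + d) = ofC c + ofC d.
Proof. by case: c d => [a b] [a' b']. Qed.

Lemma ofCB c d : ofC (c - d) = ofC c - ofC d.
Proof. by case: c d => [a b] [a' b']. Qed.

(** The factor 2 is the price of the maximum norm on [R * R]. *)
Lemma norm_ofCM c d : `|ofC (c * d)| <= 2 * `|ofC c| * `|ofC d|.
Proof.
case: c d => [a b] [a' b']; rewrite /ofC; simpc => /=.
rewrite !prod_normE /=.
have ha : `|a| <= Num.max `|a| `|b| by rewrite le_max lexx.
have hb : `|b| <= Num.max `|a| `|b| by rewrite le_max lexx orbT.
have ha' : `|a'| <= Num.max `|a'| `|b'| by rewrite le_max lexx.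
have hb' : `|b'| <= Num.max `|a'| `|b'| by rewrite le_max lexx orbT.
move: (Num.max _ _) (Num.max _ _) ha hb ha' hb' => m m' ha hb ha' hb'.
rewrite -mulrA mulr_natl mulr2n ge_max; apply/andP; split;
  (apply: le_trans (ler_normD _ _) _); rewrite ?normrN !normrM;
  by apply: lerD; apply: ler_pM.
Qed.

Lemma norm_ofC_conj c : `|ofC c^*| = `|ofC c|.
Proof. by case: c => a b; rewrite !prod_normE /= normrN. Qed.

Lemma norm_ofC_real (a : R) : `|ofC a%:C| = `|a|.
Proof. by rewrite prod_normE /= normr0; exact/max_l. Qed.

Lemma norm_Im_ofC c : `|complex.Im c| <= `|ofC c|.
Proof. by rewrite prod_normE /= le_max lexx orbT. Qed.

(** The estimates use a real norm and real scalars, so values are read in [R * R] through [ofC]. *)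
Definition complex_lipschitz f := ball_lipschitz (fun x => ofC (f x)).

Lemma complex_lipschitzD f g : complex_lipschitz f -> complex_lipschitz g ->
  complex_lipschitz (fun x => f x + g x).
Proof.
move=> hf hg; rewrite /complex_lipschitz.
have -> : (fun x => ofC (f x + g x)) = (fun x => ofC (f x) + ofC (g x)).
  by apply/funext => x; rewrite ofCD.
exact: ball_lipschitzD.
Qed.

Lemma complex_lipschitzM f g : complex_lipschitz f -> complex_lipschitz g ->
  complex_lipschitz (fun x => f x * g x).
Proof.
move=> hf hg; rewrite /complex_lipschitz.
have -> : (fun x => ofC (f x * g x))
    = (fun x => ofC (toC (ofC (f x)) * toC (ofC (g x)))).
  by apply/funext => x; rewrite !ofCK.
apply: (@ball_lipschitz_bilinear _ _ _ _ _ 2 (fun u v => ofC (toC u * toC v)))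
  => //.
  by move=> u v; have := norm_ofCM (toC u) (toC v); rewrite !toCK.
move=> [a b] [a' b'] [c d] [c' d']; rewrite /ofC /toC; simpc.
by congr (_, _) => /=; ring.
Qed.

Lemma complex_lipschitz_cst c : complex_lipschitz (fun=> c).
Proof. exact: ball_lipschitz_cst. Qed.

Lemma complex_lipschitz_conj f : complex_lipschitz f ->
  complex_lipschitz (fun x => (f x)^*).
Proof.
move=> hf; have := @ball_lipschitz_comp _ _ _ _ 1 _ (fun u => ofC (toC u)^*)
  ler01 _ hf; rewrite /complex_lipschitz.
under eq_fun do rewrite ofCK; apply=> u v.
by rewrite -ofCB -rmorphB norm_ofC_conj mul1r ofCB !toCK.
Qed.

Lemma complex_lipschitz_real (s : V -> R) : ball_lipschitz s ->
  complex_lipschitz (fun x => (s x)%:C).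
Proof.
move=> hs; apply: (@ball_lipschitz_comp R V R (R * R)%type 1 s
  (fun a => ofC a%:C)) => // a b.
by rewrite -ofCB -rmorphB norm_ofC_real mul1r.
Qed.

Lemma ball_lipschitz_Re f : complex_lipschitz f ->
  ball_lipschitz (fun x => complex.Re (f x)).
Proof.
move=> hf; apply: (@ball_lipschitz_comp R V (R * R)%type R 1
  (fun x => ofC (f x)) fst) => // a b.
by rewrite mul1r prod_normE le_max lexx.
Qed.

Lemma ball_lipschitz_Im f : complex_lipschitz f ->
  ball_lipschitz (fun x => complex.Im (f x)).
Proof.
move=> hf; apply: (@ball_lipschitz_comp R V (R * R)%type R 1
  (fun x => ofC (f x)) snd) => // a b.
by rewrite mul1r prod_normE le_max lexx orbT.
Qed.

End ComplexFunctions.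

(** * Complex partial derivatives with quadratic Taylor remainder *)

Section Partials.
Variable R : realType.
Local Notation V := (C2 R).
Implicit Types (f g : V -> R[i]) (z w : V).

Definition zx z : R[i] := toC z.1.
Definition zy z : R[i] := toC z.2.

Lemma complex_lipschitz_zx : complex_lipschitz zx.
Proof.
move=> r; exists 1 => // z w _ _.
by rewrite !toCK mul1r [leRHS]prod_normE le_max lexx.
Qed.

Lemma complex_lipschitz_zy : complex_lipschitz zy.
Proof.
move=> r; exists 1 => // z w _ _.
by rewrite !toCK mul1r [leRHS]prod_normE le_max lexx orbT.
Qed.

(** The bounds that the flow estimates use: everything is Lipschitz on balls, and the Taylor
    remainder is quadratic, uniformly on balls. They propagate through sums and products, so that no
    formula for the derivatives of a polynomial is called for. *)
Record has_partials f fx fy : Prop := HasPartials {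
  partials_lip : complex_lipschitz f;
  partials_lipx : complex_lipschitz fx;
  partials_lipy : complex_lipschitz fy;
  partials_taylor : forall r, exists2 C, 0 <= C &
    forall z w, `|z| <= r -> `|w| <= r ->
    `|ofC (f (z + w) - f z - (fx z * zx w + fy z * zy w))| <= C * `|w| ^+ 2 }.

Lemma has_partials_ext f g fx fy :
  f =1 g -> has_partials f fx fy -> has_partials g fx fy.
Proof. by move=> /funext ->. Qed.

Lemma has_partials_cst (c : R[i]) : has_partials (fun=> c) (fun=> 0) (fun=> 0).
Proof.
split; try exact: complex_lipschitz_cst.
move=> r; exists 0 => // z w _ _; rewrite !mul0r subrr addr0 subr0.
by rewrite prod_normE /= normr0 maxxx.
Qed.

Lemma has_partials_zx : has_partials zx (fun=> 1) (fun=> 0).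
Proof.
split; try exact: complex_lipschitz_cst; first exact: complex_lipschitz_zx.
move=> r; exists 0 => // z w _ _; rewrite !mul0r mul1r addr0.
have -> : zx (z + w) = zx z + zx w by [].
by rewrite -addrA -opprD subrr prod_normE /= normr0 maxxx.
Qed.

Lemma has_partials_zy : has_partials zy (fun=> 0) (fun=> 1).
Proof.
split; try exact: complex_lipschitz_cst; first exact: complex_lipschitz_zy.
move=> r; exists 0 => // z w _ _; rewrite !mul0r mul1r add0r.
have -> : zy (z + w) = zy z + zy w by [].
by rewrite -addrA -opprD subrr prod_normE /= normr0 maxxx.
Qed.

Lemma has_partialsD f fx fy g gx gy : has_partials f fx fy ->
  has_partials g gx gy ->
  has_partials (fun z => f z + g z) (fun z => fx z + gx z) (fun z => fy z + gy z).
Proof.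
case=> f0 f1 f2 ft [g0 g1 g2 gt]; split; try exact: complex_lipschitzD.
move=> r; have [C C0 hC] := ft r; have [D D0 hD] := gt r.
exists (C + D); first exact: addr_ge0.
move=> z w zr wr; rewrite [leRHS]mulrDl; apply: le_trans _ (lerD (hC z w zr wr) (hD z w zr wr)).
apply: le_trans _ (ler_normD _ _); rewrite -ofCD.
by apply: eq_ler; congr (`|ofC _|); ring.
Qed.

Lemma norm_ofCM_le (a b : R[i]) (A B : R) : `|ofC a| <= A -> `|ofC b| <= B ->
  `|ofC (a * b)| <= 2 * A * B.
Proof.
move=> ha hb; apply: le_trans (norm_ofCM _ _) _.
by rewrite -!mulrA ler_wpM2l// ler_pM.
Qed.

Lemma has_partialsM f fx fy g gx gy : has_partials f fx fy ->
  has_partials g gx gy ->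
  has_partials (fun z => f z * g z) (fun z => fx z * g z + f z * gx z)
    (fun z => fy z * g z + f z * gy z).
Proof.
case=> f0 f1 f2 ft [g0 g1 g2 gt].
split; first exact: complex_lipschitzM.
- by apply: complex_lipschitzD; exact: complex_lipschitzM.
- by apply: complex_lipschitzD; exact: complex_lipschitzM.
move=> r; have [C C0 hC] := ft r; have [D D0 hD] := gt r.
have [Lf Lf0 hf] := f0 (`|r| + `|r|); have [Lg Lg0 hg] := g0 (`|r| + `|r|).
have [Bf Bf0 bf] := ball_lipschitz_bounded r f0.
have [Bg Bg0 bg] := ball_lipschitz_bounded r g0.
exists (2 * Lf * Lg + 2 * C * Bg + 2 * Bf * D).
  by rewrite !addr_ge0 ?mulr_ge0.
move=> z w zr wr.
have zr' : `|z| <= `|r| + `|r|.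
  by apply: le_trans zr (le_trans (ler_norm r) _); rewrite lerDl.
have zwr : `|z + w| <= `|r| + `|r|.
  apply: le_trans (ler_normD _ _) _.
  by apply: lerD; [apply: le_trans zr _|apply: le_trans wr _]; exact: ler_norm.
have df : `|ofC (f (z + w) - f z)| <= Lf * `|w|.
  by rewrite ofCB; apply: le_trans (hf _ _ zwr zr') _; rewrite addrAC subrr add0r.
have dg : `|ofC (g (z + w) - g z)| <= Lg * `|w|.
  by rewrite ofCB; apply: le_trans (hg _ _ zwr zr') _; rewrite addrAC subrr add0r.
(* The remainder of a product is the product of the two increments, which is already quadratic, plus
   each remainder times the other factor at [z]. *)
have -> : f (z + w) * g (z + w) - f z * g z -
    ((fx z * g z + f z * gx z) * zx w + (fy z * g z + f z * gy z) * zy w) =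
  (f (z + w) - f z) * (g (z + w) - g z)
  + (f (z + w) - f z - (fx z * zx w + fy z * zy w)) * g z
  + f z * (g (z + w) - g z - (gx z * zx w + gy z * zy w)) by ring.
rewrite !ofCD [leRHS]mulrDl (mulrDl (_ * Lg)).
apply: le_trans (ler_normD _ _) _; apply: lerD.
  apply: le_trans (ler_normD _ _) _; apply: lerD.
    by apply: le_trans (norm_ofCM_le df dg) _; apply: eq_ler; ring.
  apply: le_trans (norm_ofCM_le (hC z w zr wr) (bg z zr)) _.
  by apply: eq_ler; ring.
apply: le_trans (norm_ofCM_le (bf z zr) (hD z w zr wr)) _.
by apply: eq_ler; ring.
Qed.

(** Horner induction in x, whose coefficients are treated by the same induction in y. *)
Lemma has_partials_poly (f : poly2 R) : exists fx fy,
  has_partials (fun z => eval2 f (zx z) (zy z)) fx fy.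
Proof.
rewrite /eval2; elim/poly_ind: f => [|q c [qx [qy hq]]].
  exists (fun=> 0), (fun=> 0); apply: has_partials_ext (has_partials_cst 0) => z.
  by rewrite !horner0.
have [cx [cy hc]] : exists cx cy, has_partials (fun z => c.[zy z]) cx cy.
  elim/poly_ind: c => [|p a [px [py hp]]].
    exists (fun=> 0), (fun=> 0).
    by apply: has_partials_ext (has_partials_cst 0) => z; rewrite horner0.
  do 2 eexists; apply: has_partials_ext
    (has_partialsD (has_partialsM hp has_partials_zy) (has_partials_cst a)) => z.
  by rewrite hornerMXaddC.
do 2 eexists; apply: has_partials_ext
  (has_partialsD (has_partialsM hq has_partials_zx) hc) => z.
by rewrite hornerMXaddC hornerD hornerM hornerC.
Qed.

End Partials.

(** * The phase of f along the flow *)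

Section Trig.
Variable R : realType.
Implicit Type h : R.

Lemma mean_value_bound (g dg : R -> R) (C h : R) :
  (forall x : R, is_derive x 1 g (dg x)) -> (forall x, `|dg x| <= C * `|x|) ->
  0 <= C -> 0 <= h -> `|g h - g 0| <= C * h ^+ 2.
Proof.
move=> dgE dgC C0; rewrite le_eqVlt => /predU1P[<-|h0].
  by rewrite subrr normr0 expr0n mulr0.
have [] := @MVT _ g dg 0 h h0 (fun x _ => dgE x).
  apply: continuous_subspaceT => x; apply/differentiable_continuous.
  by apply/derivable1_diffP; have [] := dgE x.
move=> c; rewrite in_itv /= subr0 => /andP[c0 ch] ->.
rewrite normrM (gtr0_norm h0) expr2 mulrA ler_wpM2r ?(ltW h0)//.
apply: le_trans (dgC c) _.
by rewrite ler_wpM2l// gtr0_norm// ltW.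
Qed.

Lemma norm_sin_le h : `|sin h| <= `|h|.
Proof.
wlog h0 : h / 0 <= h.
  move=> H; have [|h0] := leP 0 h; first exact: H.
  by rewrite -normrN -(normrN h) -sinN H// oppr_ge0 ltW.
move: h0; rewrite le_eqVlt => /predU1P[<-|h0]; first by rewrite sin0.
have [] := @MVT _ sin cos 0 h h0 (fun x _ => is_derive_sin x).
  by apply: continuous_subspaceT => x; exact: continuous_sin.
move=> c _; rewrite sin0 !subr0 => ->; rewrite normrM ler_piMl//.
exact: cos_max.
Qed.

Lemma norm_cosB1_le h : `|cos h - 1| <= h ^+ 2.
Proof.
wlog h0 : h / 0 <= h.
  move=> H; have [|h0] := leP 0 h; first exact: H.
  by rewrite -cosN -sqrrN H// oppr_ge0 ltW.
rewrite -(@cos0 R) -[leRHS]mul1r.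
apply: (@mean_value_bound cos (fun x => - sin x)) => // x.
by rewrite normrN mul1r norm_sin_le.
Qed.

(** This is the imaginary part of [cis (- h) * (1 +i* h)], where the first-order terms cancel. *)
Lemma norm_sinB_le h : `|h * cos h - sin h| <= h ^+ 2.
Proof.
wlog h0 : h / 0 <= h.
  move=> H; have [|h0] := leP 0 h; first exact: H.
  have -> : h * cos h - sin h = - (- h * cos (- h) - sin (- h)).
    by rewrite cosN sinN; ring.
  by rewrite normrN -(sqrrN h) H// oppr_ge0 ltW.
have := @mean_value_bound (fun x => x * cos x - sin x) (fun x => - (x * sin x))
  1 h _ _ ler01 h0.
rewrite mul0r sin0 !subr0 mul1r; apply=> x.
  by apply: is_derive_eq; rewrite /GRing.scale /=; ring.
rewrite normrN normrM mulrC; apply: ler_wpM2r => //; exact: sin_max.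
Qed.

Lemma norm_ofC_cis h : `|ofC (cis h)| <= 1.
Proof. by rewrite prod_normE ge_max /= cos_max sin_max. Qed.

Lemma norm_cisNB1 h : `|ofC (cis (- h) - 1)| <= 2 * `|h|.
Proof.
rewrite /cis cosN sinN prod_normE /= subr0 normrN ge_max; apply/andP; split.
  have [h1|h1] := leP `|h| 1.
    apply: le_trans (norm_cosB1_le h) _.
    rewrite -real_normK ?num_real// expr2.
    by apply: ler_pM => //; lra.
  apply: le_trans (ler_normD _ _) _; rewrite normrN1.
  by have := cos_max h; lra.
by apply: le_trans (norm_sin_le h) _; rewrite mulr_natl mulr2n lerDl.
Qed.

(** To first order the flow multiplies f by [1 +i* h] and a real factor; turning back by [h] leaves
    an error of order two. *)
Lemma norm_cisN_taylor h :
  `|ofC (cis (- h) * (1 +i* h) - 1)| <= 2 * h ^+ 2.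
Proof.
rewrite /cis cosN sinN; simpc; rewrite prod_normE /=.
rewrite ge_max; apply/andP; split.
  have -> : cos h + sin h * h - 1 = (cos h - 1) + sin h * h by ring.
  apply: le_trans (ler_normD _ _) _; rewrite mulr_natl mulr2n lerD//.
    exact: norm_cosB1_le.
  by rewrite normrM -[h ^+ 2]real_normK ?num_real// expr2 ler_wpM2r// norm_sin_le.
rewrite mulrC; apply: le_trans (norm_sinB_le h) _.
by rewrite mulr_natl mulr2n lerDl sqr_ge0.
Qed.

End Trig.

Section Phase.
Variable R : realType.
Local Notation V := (C2 R).
Variables (f fx fy : V -> R[i]) (X : V -> V) (Phi : R -> V -> V) (S : set V).
Variables (rho M C Lam : R) (lam : V -> R).
Hypothesis fP : has_partials f fx fy.
Hypothesis S_bounded : forall z, S z -> `|z| <= rho.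
Hypothesis XM : forall z, `|X z| <= M.
Hypothesis C0 : 0 <= C.
Hypothesis PhiX : forall t z, `|Phi t z - z - t *: X z| <= t ^+ 2 * C.
Hypothesis Phi_dyadic : forall n t z, Phi t z = iter (2 ^ n) (Phi (t / 2 ^+ n)) z.
Hypothesis Phi0 : forall z, Phi 0 z = z.
Hypothesis PhiNK : forall t z, Phi (- t) (Phi t z) = z.
Hypothesis Phi_cont : forall z, continuous (fun t => Phi t z).
Hypothesis PhiS : forall t z, S z -> S (Phi t z).
Hypothesis lamB : forall z, S z -> `|lam z| <= Lam.
Hypothesis dfX : forall z, S z ->
  fx z * zx (X z) + fy z * zy (X z) = f z * (lam z +i* 1).

(** The Taylor formula for [f] is combined with the first-order expansion of [Phi], and [dfX]
    evaluates the linear term. The constant is uniform over [S], so the errors can be added up along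
    an orbit. *)
Lemma phase_step (T : R) : exists2 B, 0 <= B & forall h z, `|h| <= T -> S z ->
  `|ofC (f (Phi h z) - f z * (1 +i* h + (h * lam z)%:C))| <= B * h ^+ 2.
Proof.
(* A bound for the displacement [Phi h z - z], which is the increment put into the Taylor
   estimate. *)
pose rw := T * M + T ^+ 2 * C.
have [D D0 hD] := partials_taylor fP (Num.max rho rw).
have [Bx Bx0 bx] := ball_lipschitz_bounded rho (partials_lipx fP).
have [By By0 by_] := ball_lipschitz_bounded rho (partials_lipy fP).
exists (D * (M + T * C) ^+ 2 + 2 * Bx * C + 2 * By * C).
  have := sqr_ge0 (M + T * C); move: (_ ^+ 2) => m m0.
  by rewrite !addr_ge0 ?mulr_ge0.
move=> h z hT Sz.
set w := Phi h z - z.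
have T0 : 0 <= T by apply: le_trans hT.
have M0 : 0 <= M by exact: le_trans (XM z).
have w1 : `|w| <= `|h| * (M + T * C).
  rewrite -(subrK (h *: X z) w); apply: le_trans (ler_normD _ _) _.
  rewrite addrC mulrDr; apply: lerD; first by rewrite normrZ ler_wpM2l.
  apply: le_trans (PhiX h z) _.
  by rewrite -real_normK ?num_real// expr2 -!mulrA ler_wpM2l// ler_wpM2r.
have w2 : `|w| <= rw.
  apply: le_trans w1 _; rewrite /rw expr2 -mulrA -mulrDr.
  by rewrite ler_wpM2r// addr_ge0 ?mulr_ge0.
have -> : Phi h z = z + w by rewrite addrC subrK.
have hx : `|ofC (zx (w - h *: X z))| <= C * h ^+ 2.
  rewrite mulrC; apply: le_trans (PhiX h z).
  by rewrite toCK [leRHS]prod_normE le_max lexx.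
have hy : `|ofC (zy (w - h *: X z))| <= C * h ^+ 2.
  rewrite mulrC; apply: le_trans (PhiX h z).
  by rewrite toCK [leRHS]prod_normE le_max lexx orbT.
have -> : f (z + w) - f z * (1 +i* h + (h * lam z)%:C) =
    (f (z + w) - f z - (fx z * zx w + fy z * zy w))
    + fx z * zx (w - h *: X z) + fy z * zy (w - h *: X z).
  have -> : 1 +i* h + (h * lam z)%:C = 1 + h%:C * (lam z +i* 1).
    by simpc; congr (_ +i* _); ring.
  have Ex : zx (w - h *: X z) = zx w - h%:C * zx (X z).
    by rewrite /zx /toC /=; simpc.
  have Ey : zy (w - h *: X z) = zy w - h%:C * zy (X z).
    by rewrite /zy /toC /=; simpc.
  rewrite Ex Ey mulrDr mulr1 mulrCA -dfX//; ring.
rewrite ofCD [ofC (_ + fx z * _)]ofCD !(mulrDl _ _ (h ^+ 2)).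
apply: le_trans (ler_normD _ _) _; apply: lerD.
  apply: le_trans (ler_normD _ _) _; apply: lerD.
    apply: le_trans (hD z w _ _) _.
    - by rewrite le_max S_bounded.
    - by rewrite le_max w2 orbT.
    rewrite -mulrA ler_wpM2l// -(real_normK (num_real h)) -exprMn.
    rewrite ler_pXn2r ?nnegrE ?mulr_ge0 ?addr_ge0 ?mulr_ge0//.
    by rewrite mulrC.
  by apply: le_trans (norm_ofCM_le (bx z (S_bounded Sz)) hx) _;
    apply: eq_ler; ring.
by apply: le_trans (norm_ofCM_le (by_ z (S_bounded Sz)) hy) _;
  apply: eq_ler; ring.
Qed.

Lemma iter_PhiS h n z : S z -> S (iter n (Phi h) z).
Proof. by move=> Sz; elim: n => [//|n ih]; rewrite iterS; exact: PhiS. Qed.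

(* [phase_step] makes the imaginary part of [kappa * cis (- t) * f (Phi t z)] obey
   a discrete Gronwall inequality along the dyadic subdivisions of [t]; [kappa] is
   arbitrary so that the case [f z = 0] also gives that the zero set is invariant. *)
Lemma phase_line (kappa : R[i]) t z : S z -> complex.Im (kappa * f z) = 0 ->
  complex.Im (kappa * cis (- t) * f (Phi t z)) = 0.
Proof.
move=> Sz fz; have [B B0 hB] := phase_step `|t|.
have [Bf Bf0 bf] := ball_lipschitz_bounded rho (partials_lip fP).
have Lam0 : 0 <= Lam by apply: le_trans (lamB Sz).
pose K := `|ofC kappa|.
have K0 : 0 <= K by exact: normr_ge0.
pose Q := 2 * (2 * K * 1) * Bf.
have Q0 : 0 <= Q by rewrite !mulr_ge0.
pose E := 2 * Q * (2 + 2 * 2 * Lam) + 2 * (2 * K * 1) * B.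
have E0 : 0 <= E by rewrite addr_ge0 ?mulr_ge0// addr_ge0 ?mulr_ge0.
apply/eqP; rewrite -normr_le0.
apply: (@ler_exp2_0 _ _ (E * t ^+ 2 * expR (`|t| * Lam))) => n.
pose h := t / 2 ^+ n.
have ht : `|h| <= `|t|.
  rewrite -(step_total n t) ler_peMl// exprn_ege1//.
  by rewrite ler1n.
pose zz j := iter j (Phi h) z.
pose beta j := kappa * cis (- (j%:R * h)) * f (zz j).
have Sj j : S (zz j) by exact: iter_PhiS.
have betaB j : `|ofC (beta j)| <= Q.
  apply: norm_ofCM_le (bf _ (S_bounded (Sj j))).
  exact: norm_ofCM_le (lexx _) (norm_ofC_cis _).
have step j : `|complex.Im (beta j.+1)|
    <= (1 + `|h| * Lam) * `|complex.Im (beta j)| + E * h ^+ 2.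
  pose err := f (zz j.+1) - f (zz j) * (1 +i* h + (h * lam (zz j))%:C).
  have errB : `|ofC err| <= B * h ^+ 2 by exact: hB.
  pose r := (cis (- h) * (1 +i* h) - 1) + (cis (- h) - 1) * (h * lam (zz j))%:C.
  have rB : `|ofC r| <= (2 + 2 * 2 * Lam) * h ^+ 2.
    rewrite ofCD [leRHS]mulrDl; apply: le_trans (ler_normD _ _) _; apply: lerD.
      exact: norm_cisN_taylor.
    have hl : `|ofC (h * lam (zz j))%:C| <= `|h| * Lam.
      by rewrite norm_ofC_real normrM ler_wpM2l// lamB.
    apply: le_trans (norm_ofCM_le (norm_cisNB1 h) hl) _; apply: eq_ler.
    by rewrite -(real_normK (num_real h)); ring.
  (* The first factor is real, so it merely scales the imaginary part, whatever [lam] is; the terms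
     with [r] and [err] are of order two in [h]. *)
  have -> : beta j.+1 = (1 + h * lam (zz j))%:C * beta j + beta j * r
      + kappa * cis (- (j.+1%:R * h)) * err.
    rewrite /beta -natr1 mulrDl mul1r opprD cisD /err /r.
    have -> : (1 + h * lam (zz j))%:C = 1 + (h * lam (zz j))%:C :> R[i].
      by rewrite rmorphD.
    ring.
  rewrite !raddfD /= (mulrDl _ _ (h ^+ 2)) -addrA.
  apply: le_trans (ler_normD _ _) _; apply: lerD.
    case: (beta j) => a b; simpc; rewrite /= normrM ler_wpM2r//.
    apply: le_trans (ler_normD _ _) _; rewrite normr1 lerD2l normrM.
    by rewrite ler_wpM2l// lamB.
  apply: le_trans (ler_normD _ _) _; apply: lerD.
    apply: le_trans (norm_Im_ofC _) _.
    by apply: le_trans (norm_ofCM_le (betaB j) rB) _; rewrite !mulrA.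
  apply: le_trans (norm_Im_ofC _) _.
  apply: le_trans (norm_ofCM_le (norm_ofCM_le (lexx _) (norm_ofC_cis _)) errB) _.
  by rewrite !mulrA.
have := @gronwall_iter R (`|h| * Lam) (E * h ^+ 2)
  (fun j => `|complex.Im (beta j)|) (2 ^ n) _ _ _ (fun j _ => step j).
rewrite /beta /zz -Phi_dyadic natr_exp2.
have -> : 2 ^+ n * (`|h| * Lam) = `|t| * Lam by rewrite mulrA step_total.
have -> : 2 ^+ n * h = t by rewrite /h mulrCA mulfV ?mulr1// exp2_neq0.
move=> H; apply: le_trans (H _ _ _) _.
- exact: mulr_ge0.
- by rewrite mulr_ge0// sqr_ge0.
- by rewrite mul0r oppr0 cis0 mulr1 /= fz normr0.
- by apply: eq_ler; rewrite /h; have := @exp2_neq0 R n => ?; field.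
Qed.

(** [phase_line] is run backwards from [Phi t z]: if f vanishes there, its hypothesis holds for
    every [kappa], and the values 1 and i of [kappa] force both parts of [cis t * f z] to vanish. *)
Lemma flow_nonzero t z : S z -> f z != 0 -> f (Phi t z) != 0.
Proof.
move=> Sz; apply: contraNneq => f0.
have h1 kappa : complex.Im (kappa * (cis t * f z)) = 0.
  have := @phase_line kappa (- t) (Phi t z) (PhiS _ Sz).
  by rewrite opprK PhiNK f0 mulr0 mulrA => /(_ erefl).
have w0 : cis t * f z = 0.
  have := h1 1; have := h1 'i; rewrite mul1r.
  by move: (cis t * f z) => [a b]; simpc => /= -> ->.
by rewrite -[f z]mul1r -cis0 -(addNr t) cisD -mulrA w0 mulr0.
Qed.

Lemma IVT_positive (g : R -> R) t : continuous g -> (forall s, g s != 0) ->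
  0 < g 0 -> 0 < g t.
Proof.
move=> cg g0 gp; rewrite ltNge; apply/negP => gt.
have H a b : a <= b -> Num.min (g a) (g b) <= 0 <= Num.max (g a) (g b) -> False.
  move=> ab h; have [c _ gc] := IVT ab (continuous_subspaceT cg) h.
  by have := g0 c; rewrite gc eqxx.
have [t0|t0] := leP 0 t.
  by apply: (H 0 t t0); rewrite ge_min le_max gt (ltW gp) orbT.
by apply: (H t 0 (ltW t0)); rewrite ge_min le_max gt (ltW gp) orbT.
Qed.

(** With the conjugate of [f z] as [kappa], [phase_line] makes [beta] real, which fixes the phase
    only up to sign. The sign is settled by continuity: [beta] never vanishes and is |f z|^2 at time
    0. The factor r is [beta t] divided by |f z|^2. *)
Lemma flow_phase t z : S z -> f z != 0 ->
  exists2 r : R, 0 < r & f (Phi t z) = r%:C * (cis t * f z).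
Proof.
move=> Sz fz.
pose k := (f z)^*.
pose beta s := k * cis (- s) * f (Phi s z).
have kf0 : k * f z = (complex.Re (f z) ^+ 2 + complex.Im (f z) ^+ 2)%:C.
  by rewrite /k; case: (f z) => a b; simpc; congr (_ +i* _); ring.
have betaR s : beta s = (complex.Re (beta s))%:C.
  have : complex.Im (beta s) = 0 by apply: phase_line; rewrite // kf0.
  by case: (beta s) => a b /= ->.
have N0 : 0 < complex.Re (f z) ^+ 2 + complex.Im (f z) ^+ 2.
  rewrite lt_neqAle addr_ge0 ?sqr_ge0// andbT eq_sym; apply: contraNneq fz => h.
  have : k * f z = 0 by rewrite kf0 h.
  move/eqP; rewrite mulf_eq0 /k => /orP[|//].
  by rewrite conjC_eq0.
have k0 : k != 0 by rewrite conjC_eq0.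
have beta0 s : complex.Re (beta s) != 0.
  apply/eqP => h; have := betaR s; rewrite h => /eqP.
  rewrite !mulf_eq0 (negPf k0) (negPf (flow_nonzero s Sz fz)) /= orbF.
  by rewrite -normr_eq0 norm_cis oner_eq0.
have cbeta : continuous (fun s => complex.Re (beta s)).
  have -> : (fun s => complex.Re (beta s)) = (fun s =>
      (complex.Re k * cos s + complex.Im k * sin s) * complex.Re (f (Phi s z))
      - (complex.Im k * cos s - complex.Re k * sin s) * complex.Im (f (Phi s z))).
    apply/funext => s; rewrite /beta /cis cosN sinN; move: (f (Phi s z)) => w.
    clear -w; case: k w => a b [c d].
    by simpc => /=; ring.
  move=> s.
  have cF1 : complex.Re (f (Phi u z)) @[u --> s] --> complex.Re (f (Phi s z)).
    have h := ball_lipschitz_continuous (ball_lipschitz_Re (partials_lip fP)).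
    exact: (cvg_comp _ _ (@Phi_cont z s) (h (Phi s z))).
  have cF2 : complex.Im (f (Phi u z)) @[u --> s] --> complex.Im (f (Phi s z)).
    have h := ball_lipschitz_continuous (ball_lipschitz_Im (partials_lip fP)).
    exact: (cvg_comp _ _ (@Phi_cont z s) (h (Phi s z))).
  have ccos := @continuous_cos R s; have csin := @continuous_sin R s.
  apply: cvgB; apply: cvgM => //.
    by apply: cvgD; apply: cvgM => //; exact: cvg_cst.
  by apply: cvgB; apply: cvgM => //; exact: cvg_cst.
have g0 : 0 < complex.Re (beta 0).
  by rewrite /beta oppr0 cis0 mulr1 Phi0 kf0.
exists (complex.Re (beta t) / (complex.Re (f z) ^+ 2 + complex.Im (f z) ^+ 2)).
  by rewrite divr_gt0// (IVT_positive t cbeta).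
have NC : (complex.Re (f z) ^+ 2 + complex.Im (f z) ^+ 2)%:C != 0 :> R[i].
  by rewrite -kf0 mulf_neq0.
have cc : cis t * cis (- t) = 1 by rewrite -cisD subrr cis0.
apply: (mulfI k0); rewrite rmorphM fmorphV /= -betaR /beta.
move: kf0 NC; move: (_%:C) => N kfN NC.
have -> : k * (k * cis (- t) * f (Phi t z) / N * (cis t * f z)) =
  k * f (Phi t z) * (cis t * cis (- t)) * (k * f z) / N by ring.
by rewrite cc kfN mulr1 mulfK.
Qed.

End Phase.

(** * Differentials *)

Lemma scale_realE (R : realType) (x y : R) : x *: y = x * y.
Proof. by []. Qed.

(** Links explicit Taylor bounds to the differential ['d], in terms of which transversality and
    critical points are stated. *)
Lemma differential_of_taylor (R : realType) (V W : normedModType R)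
    (g : V -> W) (df : V -> W) (z : V) (C K : R) :
  linear df -> (forall w, `|df w| <= K * `|w|) -> 0 <= C ->
  (forall w, `|w| <= 1 -> `|g (z + w) - g z - df w| <= C * `|w| ^+ 2) ->
  differentiable g z /\ 'd g z = df :> (V -> W).
Proof.
move=> lin dfK C0 hg.
pose dm := GRing.isLinear.Build R V W *:%R df lin.
pose dL : {linear V -> W} := HB.pack df dm.
have cdL : continuous dL.
  apply/linear_bounded_continuous; apply/linear_boundedP; near=> r => w /=.
  by apply: le_trans (dfK w) _; rewrite ler_wpM2r.
have C1 : 0 < C + 1 by rewrite ltr_wpDl.
have E : g \o shift z = cst (g z) + dL +o_ 0 id.
  apply/eqaddoP => e e0; near=> w.
  have w1 : `|w| <= 1 by near: w; exact: nbhs0_le.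
  have w2 : `|w| <= e / (C + 1) by near: w; apply: nbhs0_le; rewrite divr_gt0.
  have -> : (g \o shift z - (cst (g z) + dL)) w = g (z + w) - g z - df w.
    by rewrite -addrA -opprD [z + w]addrC.
  apply: le_trans (hg w w1) _.
  rewrite expr2 mulrA ler_wpM2r//; move: w2; rewrite ler_pdivlMr//.
  by apply: le_trans; rewrite mulrC ler_wpM2l// lerDl.
have dE := diff_unique cdL E.
split; last exact: dE.
by apply/diff_locallyP; rewrite dE; split.
Unshelve. all: by end_near. Qed.

Section DifferentialOfPartials.
Variable R : realType.
Local Notation V := (C2 R).
Variables (f fx fy : V -> R[i]).
Hypothesis fP : has_partials f fx fy.

Lemma partials_differential z :
  differentiable (fun z => ofC (f z)) z /\
  'd (fun z => ofC (f z)) z = (fun w => ofC (fx z * zx w + fy z * zy w))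
    :> (V -> R * R).
Proof.
have [C C0 hC] := partials_taylor fP (Num.max `|z| 1).
apply: (@differential_of_taylor _ _ _ _ _ _ C
  (2 * `|ofC (fx z)| + 2 * `|ofC (fy z)|)) => //.
- move=> a u v; rewrite /zx /zy.
  have E c (u1 v1 : R * R) :
      c * toC (a *: u1 + v1) = a%:C * (c * toC u1) + c * toC v1.
    case: u1 v1 c => [u1 u2] [v1 v2] [c1 c2]; rewrite /toC; simpc.
    by congr (_ +i* _); rewrite /= !scale_realE; ring.
  rewrite !E; have S c : a *: ofC c = ofC (a%:C * c).
    by case: c => c1 c2; rewrite /ofC; simpc.
  by rewrite S -ofCD; congr ofC; ring.
- move=> w; rewrite ofCD mulrDl; apply: le_trans (ler_normD _ _) _.
  have hx : `|ofC (zx w)| <= `|w| by rewrite toCK [leRHS]prod_normE le_max lexx.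
  have hy : `|ofC (zy w)| <= `|w| by rewrite toCK [leRHS]prod_normE le_max lexx orbT.
  by apply: lerD; apply: norm_ofCM_le.
- move=> w w1; rewrite -!ofCB; apply: hC; first by rewrite le_max lexx.
  by rewrite le_max w1 orbT.
Qed.

End DifferentialOfPartials.

(** * Radial projection onto the unit circle *)

Section Normalisation.
Variable R : realType.

Definition normalize (u : R * R) : R * R := ofC (toC u / `|toC u|).

Lemma normalizeE u : normalize u =
  (u.1 / Num.sqrt (u.1 ^+ 2 + u.2 ^+ 2), u.2 / Num.sqrt (u.1 ^+ 2 + u.2 ^+ 2)).
Proof.
rewrite /normalize normc_def /= /ofC /toC -fmorphV /=; simpc.
by [].
Qed.

Lemma normalize_differentiable u : u != 0 -> differentiable normalize u.
Proof.
move=> u0.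
have N0 : 0 < u.1 ^+ 2 + u.2 ^+ 2.
  rewrite lt_neqAle addr_ge0 ?sqr_ge0// andbT eq_sym.
  apply: contraNneq u0 => /eqP; rewrite paddr_eq0 ?sqr_ge0// !sqrf_eq0.
  by case: u => a b /= /andP[/eqP-> /eqP->].
have -> : normalize = (fun v : R * R =>
    (v.1 / Num.sqrt (v.1 ^+ 2 + v.2 ^+ 2), v.2 / Num.sqrt (v.1 ^+ 2 + v.2 ^+ 2))).
  by apply/funext => v; exact: normalizeE.
have d1 : differentiable (fun v : R * R => v.1) u.
  apply: (proj1 (@differential_of_taylor _ _ _ _ (fun v => v.1) u 0 1 _ _ _ _)).
  - by [].
  - by move=> w; rewrite mul1r prod_normE le_max lexx.
  - by [].
  - by move=> w _; rewrite /= -addrA -opprD subrr normr0 mul0r.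
have d2 : differentiable (fun v : R * R => v.2) u.
  apply: (proj1 (@differential_of_taylor _ _ _ _ (fun v => v.2) u 0 1 _ _ _ _)).
  - by [].
  - by move=> w; rewrite mul1r prod_normE le_max lexx orbT.
  - by [].
  - by move=> w _; rewrite /= -addrA -opprD subrr normr0 mul0r.
have ds : differentiable (fun v : R * R => (Num.sqrt (v.1 ^+ 2 + v.2 ^+ 2))^-1) u.
  apply: differentiableV; last by rewrite gt_eqF// sqrtr_gt0.
  apply: (@differentiable_comp _ _ _ _ (fun v : R * R => v.1 ^+ 2 + v.2 ^+ 2) Num.sqrt).
    apply: differentiableD.
      exact: (differentiableM d1 d1).
    exact: (differentiableM d2 d2).
  apply/derivable1_diffP; have [] // := is_derive1_sqrt N0.
by apply: differentiable_pair; exact: differentiableM.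
Qed.

Lemma normalizeZ (u : R * R) (s : R) : 0 < s -> normalize (s *: u) = normalize u.
Proof.
move=> s0; rewrite !normalizeE /=.
have -> : (s *: u.1) ^+ 2 + (s *: u.2) ^+ 2 = s ^+ 2 * (u.1 ^+ 2 + u.2 ^+ 2).
  by rewrite !scale_realE; ring.
rewrite sqrtrM ?sqr_ge0// sqrtr_sqr gtr0_norm// !scale_realE.
have s0' : s != 0 by rewrite gt_eqF.
by congr (_, _); rewrite invfM mulrACA divff// mul1r.
Qed.

(** [normalize] is constant on open rays, so the difference quotient along [s *: u] is 0 as soon as
    [1 + h * s] is positive. *)
Lemma normalize_radial u (s : R) : u != 0 -> 'd normalize u (s *: u) = 0.
Proof.
move=> u0; rewrite -deriveE; last exact: normalize_differentiable.
have s1 : 0 < `|s| + 1 by rewrite ltr_wpDl.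
rewrite /derive; apply: cvg_lim => //.
apply: cvg_near_cst; near=> h.
have hs : 0 < 1 + h * s.
  have h1 : `|h| < (`|s| + 1)^-1 by near: h; apply: dnbhs0_lt; rewrite invr_gt0.
  have : `|h * s| < 1.
    move: h1; rewrite -[ltRHS]mul1r ltr_pdivlMr//; apply: le_lt_trans.
    by rewrite normrM ler_wpM2l// lerDl.
  by rewrite ltr_norml => /andP[]; lra.
have -> : (normalize \o shift u) (h *: (s *: u)) = normalize u.
  by rewrite /= scalerA -[X in _ + X]scale1r -scalerDl addrC normalizeZ.
by rewrite subrr scaler0.
Unshelve. all: by end_near. Qed.

End Normalisation.

(** * The vector field *)

Section PartialsAction.
Variable R : realType.
Local Notation V := (C2 R).

(** At [z + s *: w] with [s = (2 ^+ n)^-1] the linear terms of the two expansions differ by [s]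
    times a fixed number and by at most a multiple of [s ^+ 2], so that number is 0. *)
Lemma has_partials_unique (f fx fy gx gy : V -> R[i]) z :
  has_partials f fx fy -> has_partials f gx gy -> fx z = gx z /\ fy z = gy z.
Proof.
move=> fP gP.
have [C C0 hC] := partials_taylor fP (Num.max `|z| 1).
have [D D0 hD] := partials_taylor gP (Num.max `|z| 1).
have zr : `|z| <= Num.max `|z| 1 by rewrite le_max lexx.
have key (w : V) : `|w| <= 1 ->
    (fx z - gx z) * zx w + (fy z - gy z) * zy w = 0.
  move=> w1; set c := _ + _.
  suff : `|ofC c| <= 0.
    by rewrite normr_le0 => /eqP h; rewrite -[c]ofCK h.
  apply: (@ler_exp2_0 _ _ (C + D)) => n.
  set s := (2 ^+ n)^-1 : R.
  have s0 : 0 < s by rewrite invr_gt0 exp2_gt0.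
  have s1 : s <= 1 by rewrite invf_le1 ?exp2_gt0// exprn_ege1// ler1n.
  have sw : `|s *: w| <= s by rewrite normrZ gtr0_norm// ler_piMr// ltW.
  have swr : `|s *: w| <= Num.max `|z| 1.
    by rewrite le_max (le_trans sw s1) orbT.
  have := hC z _ zr swr; have := hD z _ zr swr.
  have Ex : zx (s *: w) = s%:C * zx w by rewrite /zx /toC /=; simpc.
  have Ey : zy (s *: w) = s%:C * zy w by rewrite /zy /toC /=; simpc.
  rewrite Ex Ey; set u := f _ => h1 h2.
  have := lerD h1 h2; rewrite -mulrDl.
  have sw2 : `|s *: w| ^+ 2 <= s ^+ 2 by rewrite ler_pXn2r ?nnegrE// ltW.
  move=> h3; have {}h3 := le_trans h3 (ler_wpM2l (addr_ge0 D0 C0) sw2).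
  have h4 := le_trans (ler_normB _ _) h3.
  move: h4; rewrite -ofCB.
  have -> : u - f z - (gx z * (s%:C * zx w) + gy z * (s%:C * zy w))
    - (u - f z - (fx z * (s%:C * zx w) + fy z * (s%:C * zy w))) = s%:C * c.
    by rewrite /c; ring.
  have -> : ofC (s%:C * c) = s *: ofC c.
    by case: c => a b; rewrite /ofC; simpc.
  rewrite normrZ (gtr0_norm s0) expr2 mulrA [s * _]mulrC ler_pM2r//.
  by rewrite [D + C]addrC.
have e1 : `|((1, 0), (0, 0)) : V| <= 1.
  by rewrite !prod_normE /= !normr0 normr1 !ge_max !lexx ler01.
have e2 : `|((0, 0), (1, 0)) : V| <= 1.
  by rewrite !prod_normE /= !normr0 normr1 !ge_max !lexx ler01.
have t0 : toC (0, 0) = 0 :> R[i] by [].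
have t1 : toC (1, 0) = 1 :> R[i] by [].
split; apply/eqP; rewrite -subr_eq0; apply/eqP.
  by have := key _ e1; rewrite /zx /zy /= t0 t1 mulr0 mulr1 addr0.
by have := key _ e2; rewrite /zx /zy /= t0 t1 mulr0 mulr1 add0r.
Qed.

Definition act (a b : R[i]) (z : V) : V := (ofC (a * zx z), ofC (b * zy z)).

Lemma zx_act a b z : zx (act a b z) = a * zx z.
Proof. exact: ofCK. Qed.

Lemma zy_act a b z : zy (act a b z) = b * zy z.
Proof. exact: ofCK. Qed.

Lemma actB a b y z : act a b y - act a b z = act a b (y - z).
Proof.
rewrite /act; have -> : zx (y - z) = zx y - zx z by rewrite /zx /toC /=; simpc.
have -> : zy (y - z) = zy y - zy z by rewrite /zy /toC /=; simpc.
by rewrite !mulrBr !ofCB.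
Qed.

Lemma actD a b y z : act a b (y + z) = act a b y + act a b z.
Proof.
have h := actB a b (y + z) z; rewrite addrK in h.
by rewrite -h subrK.
Qed.

Lemma actZ a b (h : R) z : act a b (h *: z) = h *: act a b z.
Proof.
case: a b z => [a a'] [b b'] [[x x'] [y y']]; rewrite /act /zx /zy /toC /ofC.
by simpc; congr ((_, _), (_, _)); rewrite /= !scale_realE; ring.
Qed.

Lemma act_lip a b y z :
  `|act a b y - act a b z| <= 2 * (`|ofC a| + `|ofC b|) * `|y - z|.
Proof.
rewrite actB; move: (y - z) => w; rewrite [leLHS]prod_normE ge_max /=.
have hx : `|ofC (zx w)| <= `|w| by rewrite toCK [leRHS]prod_normE le_max lexx.
have hy : `|ofC (zy w)| <= `|w| by rewrite toCK [leRHS]prod_normE le_max lexx orbT.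
apply/andP; split.
  apply: le_trans (norm_ofCM _ _) _; rewrite -!mulrA ler_wpM2l//.
  by rewrite mulrDl; apply: ler_wpDr; rewrite ?mulr_ge0// ler_wpM2l.
apply: le_trans (norm_ofCM _ _) _; rewrite -!mulrA ler_wpM2l//.
by rewrite mulrDl; apply: ler_wpDl; rewrite ?mulr_ge0// ler_wpM2l.
Qed.

Lemma act_norm a b z : `|act a b z| <= 2 * (`|ofC a| + `|ofC b|) * `|z|.
Proof.
have := act_lip a b z 0; rewrite subr0 => /(le_trans _); apply.
by rewrite actB subr0.
Qed.

Lemma ball_lipschitz_act a b (W : normedModType R) (g : V -> W) :
  ball_lipschitz g -> ball_lipschitz (fun z => g (act a b z)).
Proof.
move=> hg r; pose K := 2 * (`|ofC a| + `|ofC b|).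
have K0 : 0 <= K by rewrite mulr_ge0// addr_ge0.
have [C C0 hC] := hg (K * r); exists (C * K); first exact: mulr_ge0.
have aK z : `|z| <= r -> `|act a b z| <= K * r.
  by move=> zr; apply: le_trans (act_norm _ _ _) _; rewrite ler_wpM2l.
move=> x y xr yr; apply: le_trans (hC _ _ (aK _ xr) (aK _ yr)) _.
by rewrite -mulrA ler_wpM2l//; exact: act_lip.
Qed.

Lemma has_partials_act (f fx fy : V -> R[i]) a b : has_partials f fx fy ->
  has_partials (fun z => f (act a b z)) (fun z => fx (act a b z) * a)
    (fun z => fy (act a b z) * b).
Proof.
move=> [f0 f1 f2 ft]; split.
- exact: ball_lipschitz_act f0.
- apply: complex_lipschitzM; last exact: complex_lipschitz_cst.
  exact: ball_lipschitz_act f1.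
- apply: complex_lipschitzM; last exact: complex_lipschitz_cst.
  exact: ball_lipschitz_act f2.
move=> r; pose K := 2 * (`|ofC a| + `|ofC b|).
have K0 : 0 <= K by rewrite mulr_ge0// addr_ge0.
have [C C0 hC] := ft (K * r); exists (C * K ^+ 2); first by rewrite mulr_ge0// sqr_ge0.
have aK z : `|z| <= r -> `|act a b z| <= K * r.
  by move=> zr; apply: le_trans (act_norm _ _ _) _; rewrite ler_wpM2l.
move=> z w zr wr; have h := hC _ _ (aK _ zr) (aK _ wr).
rewrite -actD zx_act zy_act (mulrA (fx _)) (mulrA (fy _)) in h; apply: le_trans h _.
have aw : `|act a b w| ^+ 2 <= (K * `|w|) ^+ 2.
  by rewrite ler_pXn2r ?nnegrE ?mulr_ge0//; exact: act_norm.
by apply: le_trans (ler_wpM2l C0 aw) _; rewrite exprMn mulrA.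
Qed.

(** The two sides of the functional equation have partials by the chain rule and by the product rule
    with a constant; uniqueness equates them. *)
Lemma partials_equivariant (f fx fy : V -> R[i]) a b c z :
  has_partials f fx fy -> (forall z, f (act a b z) = c * f z) ->
  fx (act a b z) * a = c * fx z /\ fy (act a b z) * b = c * fy z.
Proof.
move=> fP fE.
have h1 := has_partials_act a b fP.
have h2 := has_partialsM (has_partials_cst c) fP.
have [] := has_partials_unique z (has_partials_ext fE h1) h2.
by rewrite !mul0r !add0r.
Qed.

End PartialsAction.

(** * The equivariant field and its algebraic identities *)

Section VectorField.
Variable R : realType.
Local Notation V := (C2 R).
Variables (f fx fy : V -> R[i]).
Implicit Types z w : V.

Definition cross z : R[i] := (zy z)^* * fx z - (zx z)^* * fy z.
Definition euler_diff z : R[i] := zx z * fx z + zy z * fy z.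
Definition mixed z : R[i] := euler_diff z * (f z)^*.
Definition denom z : R := complex.Re (cross z) ^+ 2 + complex.Im (cross z) ^+ 2
  + complex.Re (mixed z) ^+ 2.
Definition field_x z : R[i] :=
  'i * (f z * (cross z)^* * (zy z)^* + f z * (f z)^* * (complex.Re (mixed z))%:C * zx z).
Definition field_y z : R[i] :=
  'i * (- (f z * (cross z)^* * (zx z)^*) + f z * (f z)^* * (complex.Re (mixed z))%:C * zy z).

Lemma field_tangent z : complex.Re ((zx z)^* * field_x z + (zy z)^* * field_y z) = 0.
Proof.
rewrite /field_x /field_y; move: (f z) (cross z) (complex.Re _) (zx z) (zy z).
move=> [a b] [c d] m [x x'] [y y']; simpc => /=; ring.
Qed.

Lemma field_diff z : fx z * field_x z + fy z * field_y z =
  f z * ((- (complex.Re (mixed z) * complex.Im (mixed z))) +i* denom z).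
Proof.
rewrite /field_x /field_y /denom /mixed /euler_diff /cross.
move: (f z) (fx z) (fy z) (zx z) (zy z).
move=> [a b] [c d] [e g] [x x'] [y y']; simpc => /=.
by congr (_ +i* _); ring.
Qed.

(** The vectors z and (conj(y), - conj(x)) form a Hermitian-orthogonal basis. The identity expands w
    in it and applies df, whose values on the two vectors are [euler_diff z] and [cross z]. *)
Lemma cross_identity z w :
  (zx z * (zx z)^* + zy z * (zy z)^*) * (fx z * zx w + fy z * zy w) =
  euler_diff z * ((zx z)^* * zx w + (zy z)^* * zy w)
  + cross z * (zy z * zx w - zx z * zy w).
Proof. by rewrite /euler_diff /cross; ring. Qed.

End VectorField.

(** * Spheres of C^2: equations, comparison of norms, compactness *)

Section Spheres.
Variable R : realType.
Local Notation V := (C2 R).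
Implicit Types z w : V.

Lemma dotC2E z w : dotC2 z w = complex.Re ((zx z)^* * zx w + (zy z)^* * zy w).
Proof.
case: z w => [[x x'] [y y']] [[u u'] [v v']]; rewrite /dotC2 /dotC /zx /zy /toC /=.
by simpc => /=; ring.
Qed.

Lemma sphere_normE z : zx z * (zx z)^* + zy z * (zy z)^* = (dotC2 z z)%:C.
Proof.
case: z => [[x x'] [y y']]; rewrite /dotC2 /dotC /zx /zy /toC /=.
by simpc; congr (_ +i* _); ring.
Qed.

Lemma sphere3P (eps : R) z : sphere3 eps z <-> dotC2 z z = eps ^+ 2.
Proof.
rewrite /sphere3 /= !sqr_normc sphere_normE.
by split=> [[]|->].
Qed.

Lemma dotC2_sqr_norm z : `|z| ^+ 2 <= dotC2 z z.
Proof.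
case: z => [[x x'] [y y']]; rewrite /dotC2 /dotC !prod_normE /=.
have H (a : R) : `|a| ^+ 2 = a * a by rewrite real_normK ?num_real// expr2.
have p (a : R) : 0 <= a * a by rewrite -expr2 sqr_ge0.
have := (p x, p x', p y, p y') => -[[[]]] px px' py py'.
have M (a b c : R) : 0 <= a -> 0 <= b -> a ^+ 2 <= c -> b ^+ 2 <= c ->
    Num.max a b ^+ 2 <= c.
  by move=> a0 b0 ac bc; rewrite maxEle; case: ifP.
have m0 (a b : R) : 0 <= Num.max `|a| `|b| by rewrite le_max normr_ge0.
by do ![apply: (M) => //]; apply: le_trans (eq_ler (H _)) _; lra.
Qed.

Lemma dotC2_le_norm z : dotC2 z z <= 4 * `|z| ^+ 2.
Proof.
case: z => [[x x'] [y y']]; rewrite /dotC2 /dotC /=.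
set z := (x, x', (y, y')).
have H (a : R) : `|a| <= `|z| -> a * a <= `|z| ^+ 2.
  by move=> h; rewrite -expr2 -real_normK ?num_real// ler_pXn2r ?nnegrE.
have hx : `|x| <= `|z| by rewrite !prod_normE /= !le_max lexx.
have hx' : `|x'| <= `|z| by rewrite !prod_normE /= !le_max lexx ?orbT.
have hy : `|y| <= `|z| by rewrite !prod_normE /= !le_max lexx ?orbT.
have hy' : `|y'| <= `|z| by rewrite !prod_normE /= !le_max lexx ?orbT.
have := (H _ hx, H _ hx', H _ hy, H _ hy') => -[[[]]]; lra.
Qed.

Lemma ball_lipschitz_dotC2 : ball_lipschitz (fun z => dotC2 z z : R).
Proof.
have -> : (fun z => dotC2 z z)
    = (fun z => complex.Re ((zx z)^* * zx z + (zy z)^* * zy z)).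
  by apply/funext => z; rewrite dotC2E.
apply: ball_lipschitz_Re; have hx := @complex_lipschitz_zx R.
have hy := @complex_lipschitz_zy R.
by apply: complex_lipschitzD; apply: complex_lipschitzM => //;
  exact: complex_lipschitz_conj.
Qed.

Lemma sphere3_compact (eps : R) : compact (sphere3 eps : set V).
Proof.
pose I : set R := `[- `|eps|, `|eps|]%classic.
have cI : compact I by exact: segment_compact.
apply: (subclosed_compact _ (compact_setX (compact_setX cI cI) (compact_setX cI cI))).
  have -> : sphere3 eps = (fun z : V => dotC2 z z) @^-1` [set eps ^+ 2].
    by apply/seteqP; split=> z /sphere3P.
  apply: closed_comp; last exact: closed_eq.
  by move=> z _; exact: (ball_lipschitz_continuous ball_lipschitz_dotC2).
move=> z /sphere3P ez.
have zn : `|z| <= `|eps|.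
  rewrite -(@ler_pXn2r _ 2) ?nnegrE// [leRHS]real_normK ?num_real// -ez.
  exact: dotC2_sqr_norm.
case: z zn {ez} => [[x x'] [y y']]; rewrite !prod_normE /= !ge_max.
move=> /andP[/andP[h1 h2] /andP[h3 h4]].
by split; split; rewrite /I /= in_itv /= -ler_norml.
Qed.

End Spheres.

(** * Positivity of the denominator D on the sphere *)

Section Positivity.
Variables (R : realType) (f : poly2 R) (fx fy : C2 R -> R[i]) (eps : R).
Local Notation F := (fun z : C2 R => eval2 f (zx z) (zy z)).
Hypothesis fP : has_partials F fx fy.
Hypothesis eps0 : 0 < eps.

Lemma polymap_differential z : differentiable (polymap f) z /\
  'd (polymap f) z = (fun w => ofC (fx z * zx w + fy z * zy w))
    :> (C2 R -> R * R).
Proof. exact: (partials_differential fP z). Qed.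

Lemma milnor_mapE : milnor_map f = @normalize R \o polymap f.
Proof. by apply/funext => z; rewrite /= /normalize /polymap ofCK. Qed.

(** The Hermitian product of a tangent vector with z is purely imaginary. Once [cross] vanishes, df
    therefore maps the tangent space into the real multiples of i e, where e is [euler_diff z]. *)
Lemma tangent_diff z w : sphere3 eps z -> cross fx fy z = 0 ->
  tangent_sphere3 z w -> exists r : R,
  (eps ^+ 2)%:C * (fx z * zx w + fy z * zy w) = euler_diff fx fy z * (0 +i* r).
Proof.
move=> /sphere3P Sz c0; rewrite /tangent_sphere3 /= dotC2E => tw.
exists (complex.Im ((zx z)^* * zx w + (zy z)^* * zy w)).
have := cross_identity fx fy z w; rewrite c0 mul0r addr0 sphere_normE Sz => ->.
by congr (_ * _); move: tw; case: (_ + _) => a b /= ->.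
Qed.

(** If D = 0, then s = 0 and m = 0. On the link, df then has real rank at most one on the tangent
    space, against transversality. Off the link, m = 0 means e = i c f with c real, so df(w) is a
    real multiple of f for every tangent w; such radial directions are killed by the differential of
    f/|f|, and the point is critical. *)
Lemma denom_positive z : sphere3 eps z -> transverse_link f eps ->
  (~ zero_set f z -> ~ milnor_critical f z) -> 0 < denom F fx fy z.
Proof.
move=> Sz tl nc.
have e2 : (eps ^+ 2)%:C != 0 :> R[i].
  by rewrite eq_complex /= eqxx andbT expf_neq0// gt_eqF.
have d0 : 0 <= denom F fx fy z by rewrite !addr_ge0// sqr_ge0.
rewrite lt_neqAle d0 andbT eq_sym; apply/eqP => /eqP.
rewrite /denom paddr_eq0 ?addr_ge0 ?sqr_ge0// paddr_eq0 ?sqr_ge0// !sqrf_eq0.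
move=> /andP[/andP[/eqP c1 /eqP c2] /eqP m0].
have c0 : cross fx fy z = 0 by move: c1 c2; case: cross => a b /= -> ->.
have [dP dE] := polymap_differential z.
have [fz|fz] := eqVneq (F z) 0.
  pose e := euler_diff fx fy z.
  (* The target is out of reach of the real multiples of i e: e itself, or 1 when e = 0. *)
  have [w tw] := tl z (conj Sz fz) (ofC (if e == 0 then 1 else e)).
  rewrite dE => /(congr1 (@toC R)); rewrite !ofCK => dw.
  have [r] := tangent_diff Sz c0 tw; rewrite dw -/e.
  have [->|en0] := eqVneq e 0.
    by rewrite mulr1 mul0r => /eqP; rewrite (negPf e2).
  rewrite mulrC => /(mulfI en0) /(congr1 (@complex.Re R)) /= /eqP.
  by rewrite expf_eq0 /= gt_eqF.
have := nc (fun h => negP fz (introT eqP h)).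
rewrite /milnor_critical => /contrapT crit.
pose u := milnor_map f z.
have u1 : `|toC u| = 1.
  by rewrite ofCK normf_div normr_id divff// normr_eq0.
(* The test vector is i u, the unit tangent vector of the circle at [u]. *)
have [|w tw dw] := crit (- u.2, u.1).
  by rewrite /tangent_circle /dotC /= -/u mulrN mulrC addNr.
have fz' : polymap f z != 0.
  by apply: contraNneq fz => h; rewrite -[F z]ofCK -/(polymap f z) h.
have [r hr] := tangent_diff Sz c0 tw.
have [s ds] : exists s : R, fx z * zx w + fy z * zy w = s%:C * F z.
  pose N := complex.Re (F z) ^+ 2 + complex.Im (F z) ^+ 2.
  have NE : F z * (F z)^* = N%:C.
    by rewrite /N; case: (F z) => a b; simpc; congr (_ +i* _); ring.
  have N0 : N%:C != 0 :> R[i] by rewrite -NE mulf_neq0// conjC_eq0.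
  have mE : mixed F fx fy z = 0 +i* complex.Im (mixed F fx fy z).
    by move: m0; case: mixed => a b /= ->.
  exists (- (complex.Im (mixed F fx fy z) * r) / (eps ^+ 2 * N)).
  apply: (mulfI e2); apply: (mulfI N0); rewrite hr.
  have -> : N%:C * (euler_diff fx fy z * (0 +i* r))
      = mixed F fx fy z * (0 +i* r) * F z by rewrite -NE /mixed; ring.
  rewrite mE.
  have -> : (0 +i* complex.Im (mixed F fx fy z)) * (0 +i* r)
      = (- (complex.Im (mixed F fx fy z) * r))%:C by simpc.
  have -> (a b c : R) : (a / (b * c))%:C = a%:C / (b%:C * c%:C) :> R[i].
    by rewrite -[b%:C * _]rmorphM -fmorphV -rmorphM.
  by move: e2 N0; move: (eps ^+ 2)%:C N%:C => d n d0' n0'; field; rewrite d0' n0'.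
have : 'd (milnor_map f) z w = 0.
  rewrite milnor_mapE diff_comp//; last exact: normalize_differentiable.
  rewrite /= dE ds.
  have -> : ofC (s%:C * F z) = s *: polymap f z.
    by rewrite /polymap; case: eval2 => a b; rewrite /ofC; simpc.
  exact: normalize_radial.
rewrite dw => h.
have h1 : u.1 = 0 := congr1 snd h.
have h2 : u.2 = 0 by apply: oppr_inj; rewrite oppr0; exact: (congr1 fst h).
have u0 : toC u = 0 by rewrite /toC h1 h2.
by move/eqP: u1; rewrite u0 normr0 eq_sym oner_eq0.
Qed.

End Positivity.

Section RealLipschitz.
Variable R : realType.

Lemma max_lipschitz (a b c : R) : `|Num.max a c - Num.max b c| <= `|a - b|.
Proof.
have h1 := ler_norm (a - b); have h2 := ler_norm (b - a); rewrite distrC in h2.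
rewrite !maxEle ler_norml; case: (leP a c) => ac; case: (leP b c) => bc;
  apply/andP; split; lra.
Qed.

Lemma max_inv_lipschitz (a b d : R) : 0 < d ->
  `|(Num.max a d)^-1 - (Num.max b d)^-1| <= (d ^+ 2)^-1 * `|a - b|.
Proof.
move=> d0; have ha : d <= Num.max a d by rewrite le_max lexx orbT.
have hb : d <= Num.max b d by rewrite le_max lexx orbT.
have := max_lipschitz a b d; move: (Num.max a d) (Num.max b d) ha hb => u v du dv uv.
have u0 : 0 < u by exact: lt_le_trans du.
have v0 : 0 < v by exact: lt_le_trans dv.
have -> : u^-1 - v^-1 = (u * v)^-1 * (v - u).
  by field; rewrite !gt_eqF.
rewrite normrM gtr0_norm ?invr_gt0 ?mulr_gt0// distrC.
apply: ler_pM => //; first by rewrite invr_ge0 mulr_ge0// ltW.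
rewrite lef_pV2 ?posrE ?exprn_gt0 ?mulr_gt0// expr2.
by apply: ler_pM => //; exact: ltW.
Qed.

End RealLipschitz.

(** * The flow on the sphere: Lipschitz bounds, tangency, equivariance *)

Section MilnorFlow.
Variable R : realType.
Local Notation V := (C2 R).
Variables (f fx fy : V -> R[i]) (eps : R).
Hypothesis fP : has_partials f fx fy.

Let hx := @complex_lipschitz_zx R.
Let hy := @complex_lipschitz_zy R.
Let hf := partials_lip fP.
Let hfx := partials_lipx fP.
Let hfy := partials_lipy fP.

Lemma complex_lipschitzN (g : V -> R[i]) :
  complex_lipschitz g -> complex_lipschitz (fun z => - g z).
Proof.
move=> hg; have -> : (fun z => - g z) = (fun z => (-1) * g z).
  by apply/funext => z; rewrite mulN1r.
by apply: complex_lipschitzM => //; exact: complex_lipschitz_cst.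
Qed.

Lemma complex_lipschitz_cross : complex_lipschitz (cross fx fy).
Proof.
apply: complex_lipschitzD; last apply: complex_lipschitzN;
  by apply: complex_lipschitzM => //; exact: complex_lipschitz_conj.
Qed.

Lemma complex_lipschitz_mixed : complex_lipschitz (mixed f fx fy).
Proof.
apply: complex_lipschitzM; last exact: complex_lipschitz_conj.
by apply: complex_lipschitzD; exact: complex_lipschitzM.
Qed.

Lemma ball_lipschitzM (g h : V -> R) :
  ball_lipschitz g -> ball_lipschitz h -> ball_lipschitz (fun z => g z * h z).
Proof.
move=> hg hh; apply: (@ball_lipschitz_bilinear R V R R R 1 *%R g h) => //.
  by move=> u v; rewrite normrM mul1r.
by move=> u u' v v'; ring.
Qed.

Lemma ball_lipschitz_denom : ball_lipschitz (denom f fx fy).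
Proof.
have c1 := ball_lipschitz_Re complex_lipschitz_cross.
have c2 := ball_lipschitz_Im complex_lipschitz_cross.
have c3 := ball_lipschitz_Re complex_lipschitz_mixed.
apply: ball_lipschitzD; last exact: ball_lipschitzM.
by apply: ball_lipschitzD; exact: ball_lipschitzM.
Qed.

Lemma complex_lipschitz_field : complex_lipschitz (field_x f fx fy) /\
  complex_lipschitz (field_y f fx fy).
Proof.
have cj (g : V -> R[i]) : complex_lipschitz g -> complex_lipschitz (fun z => (g z)^*).
  exact: complex_lipschitz_conj.
have c := cj _ complex_lipschitz_cross.
have m := complex_lipschitz_real (ball_lipschitz_Re complex_lipschitz_mixed).
split; (apply: complex_lipschitzM; first exact: complex_lipschitz_cst);
  (apply: complex_lipschitzD; [|
    apply: complex_lipschitzM => //; apply: complex_lipschitzM => //;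
    apply: complex_lipschitzM => //; exact: cj]).
  by apply: complex_lipschitzM; [exact: complex_lipschitzM|exact: cj].
apply: complex_lipschitzN.
by apply: complex_lipschitzM; [exact: complex_lipschitzM|exact: cj].
Qed.

Lemma denom_lower_bound : (forall z, sphere3 eps z -> 0 < denom f fx fy z) ->
  exists2 delta : R, 0 < delta &
    forall z, sphere3 eps z -> delta <= denom f fx fy z.
Proof.
move=> denom0.
have [S0|S0] := pselect ((sphere3 eps : set V) !=set0); last first.
  by exists 1 => // z Sz; exfalso; apply: S0; exists z.
have cd : {within (sphere3 eps : set V), continuous (denom f fx fy)}.
  apply: continuous_subspaceT.
  exact: (ball_lipschitz_continuous ball_lipschitz_denom).
have [c /set_mem Sc hc] := compact_EVT_min S0 (@sphere3_compact R eps) cd.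
exists (denom f fx fy c); first exact: denom0.
by move=> z Sz; apply: hc; exact/mem_set.
Qed.

(* On the sphere this is [1 / denom]; it is cut off elsewhere to make
   [milnor_field] globally Lipschitz. *)
Definition cutoff (delta : R) (z : V) : R :=
  Num.max (1 - `|dotC2 z z - eps ^+ 2|) 0 * (Num.max (denom f fx fy z) delta)^-1.

Definition milnor_field (delta : R) (z : V) : V :=
  (ofC ((cutoff delta z)%:C * field_x f fx fy z),
   ofC ((cutoff delta z)%:C * field_y f fx fy z)).

Lemma ball_lipschitz_cutoff delta : 0 < delta -> ball_lipschitz (cutoff delta).
Proof.
move=> d0; apply: ball_lipschitzM.
  apply: (@ball_lipschitz_comp _ _ _ _ 1 (fun z : V => dotC2 z z)
    (fun a => Num.max (1 - `|a - eps ^+ 2|) 0)) => //; last first.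
    exact: ball_lipschitz_dotC2.
  move=> a b; apply: le_trans (max_lipschitz _ _ _) _.
  rewrite opprD addrACA subrr add0r opprK addrC mul1r.
  apply: le_trans (ler_dist_dist _ _) _.
  by rewrite opprD addrACA opprK addNr addr0 distrC.
apply: (@ball_lipschitz_comp _ _ _ _ (delta ^+ 2)^-1 (denom f fx fy)
    (fun a => (Num.max a delta)^-1)).
- by rewrite invr_ge0 sqr_ge0.
- by move=> a b; exact: max_inv_lipschitz.
- exact: ball_lipschitz_denom.
Qed.

Lemma ball_lipschitz_field delta : 0 < delta -> ball_lipschitz (milnor_field delta).
Proof.
move=> /ball_lipschitz_cutoff/complex_lipschitz_real hc.
have [h1 h2] := complex_lipschitz_field.
by apply: ball_lipschitz_pair; exact: complex_lipschitzM.
Qed.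

(** Beyond this radius the norm is at least 1, hence at most its square and at most [dotC2 z z],
    which puts [z] outside the support of the cutoff. *)
Lemma milnor_field_support delta z : eps ^+ 2 + 1 < `|z| -> milnor_field delta z = 0.
Proof.
move=> zr; suff c0 : cutoff delta z = 0.
  by rewrite /milnor_field c0 !mul0r.
have e0 := sqr_ge0 eps.
have z1 : 1 <= `|z| by apply: ltW; apply: le_lt_trans zr; rewrite lerDr.
have : `|z| <= dotC2 z z.
  by apply: le_trans (dotC2_sqr_norm z); rewrite expr2 ler_peMr.
move=> h; rewrite /cutoff (_ : Num.max _ 0 = 0) ?mul0r//.
apply/max_r; have := ler_norm (dotC2 z z - eps ^+ 2); lra.
Qed.

Lemma zx_field delta z :
  zx (milnor_field delta z) = (cutoff delta z)%:C * field_x f fx fy z.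
Proof. exact: ofCK. Qed.

Lemma zy_field delta z :
  zy (milnor_field delta z) = (cutoff delta z)%:C * field_y f fx fy z.
Proof. exact: ofCK. Qed.

Lemma milnor_field_tangent delta z : dotC2 z (milnor_field delta z) = 0.
Proof.
rewrite dotC2E zx_field zy_field.
rewrite mulrCA [(zy z)^* * _]mulrCA -mulrDr.
have := field_tangent f fx fy z; case: (_ + _) => a b /= ->.
by simpc.
Qed.

Lemma milnor_field_diff delta z : 0 < delta -> sphere3 eps z ->
  delta <= denom f fx fy z ->
  fx z * zx (milnor_field delta z) + fy z * zy (milnor_field delta z) =
  f z * ((- (complex.Re (mixed f fx fy z) * complex.Im (mixed f fx fy z)
             * cutoff delta z)) +i* 1).
Proof.
move=> d0 /sphere3P Sz dz; rewrite zx_field zy_field.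
rewrite mulrCA [fy z * _]mulrCA -mulrDr field_diff mulrCA; congr (_ * _).
have -> : cutoff delta z = (denom f fx fy z)^-1.
  rewrite /cutoff Sz subrr normr0 subr0 (max_l ler01) mul1r.
  by rewrite (max_l dz).
simpc; congr (_ +i* _); first by ring.
by rewrite mulVf// gt_eqF// (lt_le_trans d0).
Qed.

Lemma conj_unit (a : R[i]) : `|a| = 1 -> a * a^* = 1.
Proof. by move=> a1; rewrite -sqr_normc a1 expr1n. Qed.

Section Equivariance.
Variables (a b c : R[i]).
Hypotheses (a1 : `|a| = 1) (b1 : `|b| = 1) (c1 : `|c| = 1).
Hypothesis fE : forall z, f (act a b z) = c * f z.

Let aa : a * a^* = 1 := conj_unit a1.
Let bb : b * b^* = 1 := conj_unit b1.
Let cc : c * c^* = 1 := conj_unit c1.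

Lemma fx_act z : fx (act a b z) = c * a^* * fx z.
Proof.
have [h _] := partials_equivariant z fP fE.
by rewrite -[LHS]mulr1 -aa mulrA h; ring.
Qed.

Lemma fy_act z : fy (act a b z) = c * b^* * fy z.
Proof.
have [_ h] := partials_equivariant z fP fE.
by rewrite -[LHS]mulr1 -bb mulrA h; ring.
Qed.

Lemma cross_act z : cross fx fy (act a b z) = c * a^* * b^* * cross fx fy z.
Proof. by rewrite /cross fx_act fy_act zx_act zy_act !rmorphM /=; ring. Qed.

Lemma mixed_act z : mixed f fx fy (act a b z) = mixed f fx fy z.
Proof.
rewrite /mixed /euler_diff fx_act fy_act zx_act zy_act fE rmorphM /=.
transitivity ((a * a^* * (zx z * fx z) + b * b^* * (zy z * fy z))
  * (c * c^*) * (f z)^*); first by ring.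
by rewrite aa bb cc; ring.
Qed.

Lemma denom_act z : denom f fx fy (act a b z) = denom f fx fy z.
Proof.
rewrite /denom mixed_act cross_act; congr (_ + _).
have E (w : R[i]) : w * w^* = (complex.Re w ^+ 2 + complex.Im w ^+ 2)%:C.
  by case: w => x y; simpc; congr (_ +i* _); ring.
apply: complexI; rewrite -!E !rmorphM /=. rewrite !conjCK.
transitivity (c * c^* * (a * a^*) * (b * b^*) *
  (cross fx fy z * (cross fx fy z)^*)); first by ring.
by rewrite aa bb cc !mul1r.
Qed.

Lemma dotC2_act z : dotC2 (act a b z) (act a b z) = dotC2 z z.
Proof.
apply: complexI; rewrite -!sphere_normE zx_act zy_act !rmorphM /=.
transitivity (a * a^* * (zx z * (zx z)^*) + b * b^* * (zy z * (zy z)^*)).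
  by ring.
by rewrite aa bb !mul1r.
Qed.

(** Weights: s is multiplied by c conj(a) conj(b), so f conj(s) conj(y) is multiplied by a and f
    conj(s) conj(x) by b, while |f|^2 and m are invariant. *)
Lemma field_act z : field_x f fx fy (act a b z) = a * field_x f fx fy z /\
  field_y f fx fy (act a b z) = b * field_y f fx fy z.
Proof.
rewrite /field_x /field_y mixed_act cross_act fE zx_act zy_act.
rewrite !rmorphM /= !conjCK; move: (complex.Re _)%:C (cross fx fy z) => m s.
split.
  transitivity ('i * ((c * c^*) * (b * b^*) * (a * (f z * s^* * (zy z)^*))
    + (c * c^*) * (a * (f z * (f z)^* * m * zx z)))); first by ring.
  by rewrite bb cc; ring.
transitivity ('i * (- ((c * c^*) * (a * a^*) * (b * (f z * s^* * (zx z)^*)))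
  + (c * c^*) * (b * (f z * (f z)^* * m * zy z)))); first by ring.
by rewrite aa cc; ring.
Qed.

Lemma milnor_field_act delta z :
  milnor_field delta (act a b z) = act a b (milnor_field delta z).
Proof.
have [h1 h2] := field_act z.
rewrite /milnor_field /act /cutoff dotC2_act denom_act -/(act a b z) h1 h2.
by rewrite zx_field zy_field /cutoff; congr (ofC _, ofC _); ring.
Qed.

Lemma euler_milnor_act delta h z :
  act a b (euler (milnor_field delta) h z) =
  euler (milnor_field delta) h (act a b z).
Proof. by rewrite /euler actD actZ milnor_field_act. Qed.

End Equivariance.

(** Pythagoras, as the field is tangent to the concentric sphere through every point. This is the
    second-order defect that [flow_invariant] asks for. *)
Lemma dotC2_euler delta h z :
  dotC2 (euler (milnor_field delta) h z) (euler (milnor_field delta) h z)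
  = dotC2 z z + h ^+ 2 * dotC2 (milnor_field delta z) (milnor_field delta z).
Proof.
have := milnor_field_tangent delta z; rewrite /euler.
case: (milnor_field _ _) => [[u u'] [v v']]; case: z => [[x x'] [y y']].
rewrite /dotC2 /dotC /= => h0; rewrite !scale_realE.
by rewrite -[RHS]addr0 -(mulr0 (2 * h)) -h0; ring.
Qed.

Theorem milnor_flow : (forall z, sphere3 eps z -> 0 < denom f fx fy z) ->
  exists Phi : R -> V -> V,
  [/\ continuous (fun tz : R * V => Phi tz.1 tz.2),
      forall t z, Phi (- t) (Phi t z) = z,
      forall t z, sphere3 eps z -> sphere3 eps (Phi t z),
      forall t z, sphere3 eps z -> f z != 0 ->
        exists2 r : R, 0 < r & f (Phi t z) = r%:C * (cis t * f z)
    & forall a b c, `|a| = 1 -> `|b| = 1 -> `|c| = 1 ->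
        (forall z, f (act a b z) = c * f z) ->
        forall t z, act a b (Phi t z) = Phi t (act a b z)].
Proof.
move=> denom0; have [delta d0 hd] := denom_lower_bound denom0.
pose X := milnor_field delta.
have [M [L [M0 L0 XM XL]]] := ball_lipschitz_support (ball_lipschitz_field d0)
  (@milnor_field_support delta).
have Vc : geometric_complete (V : normedModType R).
  by do 2 apply: geometric_complete_prod; exact: geometric_complete_real.
have [Phi [K PhiE]] := euler_flow M0 L0 XM XL Vc.
have Pc : continuous (fun tz : R * V => Phi tz.1 tz.2).
  exact: (flow_continuous M0 L0 XM XL PhiE).
have PN : forall t z, Phi (- t) (Phi t z) = z.
  exact: (flowNK M0 L0 XM XL PhiE).
have P0 : forall z, Phi 0 z = z by exact: (flow0 PhiE).
have PS : forall t z, sphere3 eps z -> sphere3 eps (Phi t z).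
  move=> t z /sphere3P Sz; apply/sphere3P; rewrite -Sz.
  (* [M] bounds the maximum norm of the field; its four real coordinates give the factor 4 for the
     squared Euclidean norm. *)
  apply: (flow_invariant PhiE (q := fun z => dotC2 z z) (B := 4 * M ^+ 2)).
    exact: (ball_lipschitz_continuous (@ball_lipschitz_dotC2 R)).
  move=> h y; rewrite dotC2_euler addrAC subrr add0r normrM.
  rewrite ger0_norm ?sqr_ge0// ler_wpM2l ?sqr_ge0// ger0_norm; last first.
    by apply: le_trans (dotC2_sqr_norm _); exact: sqr_ge0.
  apply: le_trans (dotC2_le_norm _) _; rewrite ler_wpM2l//.
  by rewrite ler_pXn2r ?nnegrE//; exact: XM.
exists Phi; split=> //.
- have hn z : sphere3 eps z -> `|z| <= `|eps|.
    move=> /sphere3P Sz; rewrite -(@ler_pXn2r _ 2) ?nnegrE//.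
    by rewrite [leRHS]real_normK ?num_real// -Sz dotC2_sqr_norm.
  (* The rate of change of log |f| along the flow off the link; the formula stays meaningful, and
     bounded, on the whole sphere. *)
  pose lam z : R := - (complex.Re (mixed f fx fy z) * complex.Im (mixed f fx fy z)
             * cutoff delta z).
  have lamL : ball_lipschitz (fun z => complex.Re (mixed f fx fy z)
      * complex.Im (mixed f fx fy z) * cutoff delta z).
    apply: ball_lipschitzM; last exact: ball_lipschitz_cutoff.
    apply: ball_lipschitzM; [apply: ball_lipschitz_Re|apply: ball_lipschitz_Im];
      exact: complex_lipschitz_mixed.
  have [Lam Lam0 hLam] := ball_lipschitz_bounded `|eps| lamL.
  move=> t z Sz fz.
  apply: (@flow_phase R f fx fy X Phi (sphere3 eps) `|eps| M (L * M) Lam lam) => //.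
  + exact: mulr_ge0.
  + by move=> s y; rewrite mulrA; exact: (flow_first_order M0 L0 XM XL PhiE).
  + exact: (flow_dyadic M0 L0 XM XL PhiE).
  + move=> y s.
    have cs : u @[u --> s] --> s by exact: cvg_id.
    have cy : y @[_ --> s] --> y by exact: cvg_cst.
    exact: (cvg_comp _ _ (cvg_pair cs cy) (Pc (s, y))).
  + by move=> y Sy; rewrite normrN; apply: hLam; exact: hn.
  + by move=> y Sy; apply: milnor_field_diff => //; exact: hd.
- move=> a b c a1 b1 c1 fE t z.
  apply: (flow_commute PhiE (C := 2 * (`|ofC a| + `|ofC b|))).
    by move=> h y; exact: (euler_milnor_act a1 b1 c1 fE).
  by move=> y w; exact: act_lip.
Qed.

End MilnorFlow.

(** * Lens spaces *)

Lemma expz_root_of_unity (F : fieldType) (u : F) (p : nat) (m : int) :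
  (0 < p)%N -> u ^+ p = 1 -> u ^ m = u ^+ `|(m %% p)%Z|%N.
Proof.
move=> p0 up; have u0 : u != 0.
  apply/eqP => u0; move: up; rewrite u0 expr0n gtn_eqF//= => /eqP.
  by rewrite eq_sym oner_eq0.
have p0' : p%:Z != 0 by rewrite eqz_nat -lt0n.
have ud : u ^ ((m %/ p)%Z * p%:Z) = 1.
  by rewrite mulrC -exprz_exp -(exprnP u p) up exp1rz.
rewrite {1}(divz_eq m p) expfzDr// ud mul1r.
by rewrite -{1}(gez0_abs (modz_ge0 m p0')).
Qed.

Lemma norm_root_of_unity (R : numDomainType) (u : R) (p : nat) :
  (0 < p)%N -> u ^+ p = 1 -> `|u| = 1.
Proof.
move=> p0 up; apply/eqP; rewrite -(@pexpr_eq1 _ _ p)//.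
by rewrite -normrX up normr1.
Qed.

Lemma iter_act (R : realType) (a b : R[i]) n z :
  iter n (act a b) z = act (a ^+ n) (b ^+ n) z.
Proof.
elim: n => [|n ih].
  by case: z => u v; rewrite /act !expr0 !mul1r !toCK.
by rewrite iterS ih /act zx_act zy_act !mulrA -!exprS.
Qed.

Section LensFlow.
Variables (R : realType) (p : nat) (q : int) (zeta : R[i]) (eps : R).
Hypothesis hzeta : p.-primitive_root zeta.
Local Notation V := (C2 R).
Local Notation TS := (set_type (sphere3 eps : set V)).
Local Notation L := (lens_space q eps hzeta).
Local Notation pi := (@lens_proj R p q zeta eps hzeta).
Local Notation A := (act zeta (zeta ^ q)).

Let p0 : (0 < p)%N := prim_order_gt0 hzeta.
Let zp : zeta ^+ p = 1 := prim_expr_order hzeta.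

Let zqp : (zeta ^ q) ^+ p = 1.
Proof. by rewrite exprnP exprzAC -(exprnP zeta p) zp exp1rz. Qed.

Let a1 : `|zeta| = 1 := norm_root_of_unity p0 zp.
Let b1 : `|zeta ^ q| = 1 := norm_root_of_unity p0 zqp.

Lemma act_sphere z : sphere3 eps z -> sphere3 eps (A z).
Proof. by move=> /sphere3P h; apply/sphere3P; rewrite dotC2_act. Qed.

(** The integer exponents of [lens_rel] become natural numbers modulo [p], so an orbit consists of
    forward iterates of the generator. *)
Lemma lens_projP (z w : TS) :
  pi z = pi w <-> exists n, set_val w = iter n A (set_val z).
Proof.
have -> : (pi z = pi w) <-> lens_rel q zeta z w.
  have P := @eqquotP _ (lens_equiv q eps hzeta) _ z w.
  by split=> h; [apply/P; exact: h|exact/P].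
split=> [/asboolP[m [e1 e2]]|[n e]].
  exists `|(m %% p)%Z|%N; rewrite iter_act -!expz_root_of_unity//.
  by rewrite /act /zx /zy -e1 -e2 !toCK; case: (set_val w).
apply/asboolP; exists n%:Z; rewrite e iter_act -!exprnP.
by split; exact: ofCK.
Qed.

Lemma lens_proj_surj (c : L) : exists z, c = pi z.
Proof. by exists (repr c); rewrite /lens_proj reprK. Qed.


Lemma lens_proj_continuous : continuous pi.
Proof. exact: pi_continuous. Qed.

Definition act_lens (z : TS) : TS :=
  exist (fun x => x \in sphere3 eps) (A (set_val z))
    (mem_set (act_sphere (set_valP z))).

Lemma act_continuous (a b : R[i]) : continuous (act a b : V -> V).
Proof.
move=> z; apply/cvgrPdist_lt => e e0.
pose C := 2 * (`|ofC a| + `|ofC b|) + 1.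
have C0 : 0 < C by rewrite ltr_wpDl// mulr_ge0// addr_ge0.
near=> w.
have zw : `|z - w| < e / C.
  near: w; apply: (@cvgr_dist_lt _ _ _ (nbhs z) _ id); first exact: cvg_id.
  exact: divr_gt0.
apply: le_lt_trans (act_lip _ _ _ _) _.
move: zw; rewrite ltr_pdivlMr//; apply: le_lt_trans.
by rewrite mulrC ler_wpM2l// lerDl.
Unshelve. all: by end_near. Qed.

Lemma act_lens_continuous : continuous act_lens.
Proof.
move=> z; apply: (@cvg_set_type _ (nbhs z)).
have h : A (set_val w) @[w --> z] --> A (set_val z).
  exact: (cvg_comp (fun w : TS => set_val w) A (@set_val_continuous _ _ z)
    (@act_continuous zeta (zeta ^ q) (set_val z))).
exact: h.
Qed.

Lemma iter_act_lens n z : set_val (iter n act_lens z) = iter n A (set_val z).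
Proof. by elim: n => //= n <-. Qed.

Lemma iter_act_lens_continuous n : continuous (iter n act_lens).
Proof.
elim: n => [|n ih] z; first exact: cvg_id.
exact: (cvg_comp _ _ (ih z) (@act_lens_continuous (iter n act_lens z))).
Qed.

(** The saturation of [O] is the union of its preimages under the iterates of the generator.
    Openness lets continuity jointly in time and point be checked on the sphere, as in
    [lens_flow_continuous]. *)
Lemma lens_proj_open (O : set TS) : open O -> open (pi @` O).
Proof.
move=> oO.
have -> : open (pi @` O) = open (pi @^-1` (pi @` O)) by [].
have -> : pi @^-1` (pi @` O) = \bigcup_n (iter n act_lens @^-1` O).
  apply/seteqP; split=> [w [z Oz zw]|w [n _ On]].
    have /lens_projP[n e] := esym zw; exists n => //=.
    suff -> : iter n act_lens w = z by [].
    by apply: val_inj; have := iter_act_lens n w; rewrite -e set_valE.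
  exists (iter n act_lens w) => //; apply/esym/lens_projP; exists n.
  exact: iter_act_lens.
apply: bigcup_open => n _.
apply: open_comp => // z _; exact: iter_act_lens_continuous.
Qed.

Lemma nbhs_lens_proj (z : TS) (U : set L) :
  nbhs z (pi @^-1` U) -> nbhs (pi z) U.
Proof.
rewrite (nbhsE z) => -[B [oB Bz] BU].
apply: (@filterS _ _ _ (pi @` B)); first by move=> _ [w Bw <-]; exact: BU.
by apply: open_nbhs_nbhs; split; [exact: lens_proj_open|exists z].
Qed.

(** * Descent of the flow and of the fibration to the lens space *)

Section Bundle.
Variables (f : poly2 R) (k : nat) (Phi : R -> V -> V) (K : set L).
Local Notation F := (fun z : V => eval2 f (zx z) (zy z)).
Hypothesis f_equiv : forall x y : R[i],
  eval2 f (zeta * x) (zeta ^ q * y) = zeta ^+ k * eval2 f x y.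
Hypothesis f_cont : continuous (polymap f).
Hypothesis liftK : link_lift K = sphere3 eps `&` zero_set f.
Hypothesis complement_nonempty : exists z : V, sphere3 eps z /\ F z != 0.
Hypothesis Phi_cont : continuous (fun tz : R * V => Phi tz.1 tz.2).
Hypothesis PhiNK : forall t z, Phi (- t) (Phi t z) = z.
Hypothesis PhiS : forall t z, sphere3 eps z -> sphere3 eps (Phi t z).
Hypothesis PhiF : forall t z, sphere3 eps z -> F z != 0 ->
  exists2 r : R, 0 < r & F (Phi t z) = r%:C * (cis t * F z).
Hypothesis PhiA : forall t z, A (Phi t z) = Phi t (A z).

Lemma lens_proj_zero z : K (pi z) <-> F (set_val z) = 0.
Proof.
have h : link_lift K (set_val z) <-> F (set_val z) = 0.
  by rewrite liftK; split=> [[]//|h]; split=> //; exact: set_valP.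
split=> [Kz|/h[w Kw wz]]; first by apply/h; exists z.
by rewrite -(val_inj wz).
Qed.

Definition flow_lift t (z : TS) : TS :=
  exist (fun x => x \in sphere3 eps) (Phi t (set_val z))
    (mem_set (PhiS t (set_valP z))).

Definition lens_flow t (c : L) : L := pi (flow_lift t (repr c)).

Lemma iter_A_Phi n t z : iter n A (Phi t z) = Phi t (iter n A z).
Proof. by elim: n => //= n ->; exact: PhiA. Qed.

(** Independence of the representative chosen by [repr]: two of them differ by an iterate of the
    generator, which commutes with the flow. *)
Lemma lens_flow_proj t z : lens_flow t (pi z) = pi (flow_lift t z).
Proof.
have : pi (repr (pi z)) = pi z by rewrite /lens_proj reprK.
move/lens_projP => [n e]; apply/lens_projP; exists n.
by rewrite /= -/(set_val _) [LHS](congr1 (Phi t) e) iter_A_Phi.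
Qed.

Lemma lens_flow_continuous : continuous (fun tc : R * L => lens_flow tc.1 tc.2).
Proof.
move=> [t c]; have [z ->] := lens_proj_surj c => U /= nU.
rewrite lens_flow_proj in nU.
have c1 : flow_lift sw.1 sw.2 @[sw --> nbhs (t, z)] --> flow_lift t z.
  apply: (@cvg_set_type _ (nbhs (t, z))).
  have c2 : (sw.1, set_val sw.2) @[sw --> nbhs (t, z)] --> (t, set_val z).
    have d1 : sw.1 @[sw --> nbhs (t, z)] --> t by exact: cvg_fst.
    have d2 : set_val sw.2 @[sw --> nbhs (t, z)] --> set_val z.
      by apply: (cvg_comp snd _ cvg_snd); exact: set_val_continuous.
    exact: (cvg_pair d1 d2).
  have h : Phi sw.1 (set_val sw.2) @[sw --> nbhs (t, z)] --> Phi t (set_val z).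
    exact: (cvg_comp _ (fun tz : R * V => Phi tz.1 tz.2) c2
      (@Phi_cont (t, set_val z))).
  exact: h.
have /c1 [[P Q] /= [Pt Qz] PQ] := lens_proj_continuous nU.
exists (P, pi @` Q) => /=.
  split=> //; apply: nbhs_lens_proj; apply: filterS Qz => w Qw.
  by exists w.
move=> [s _] /= [Ps [w Qw <-]]; rewrite lens_flow_proj.
exact: (PQ (s, w)).
Qed.

Definition lens_milnor (c : L) : R * R :=
  ofC (toC (milnor_map f (set_val (repr c))) ^+ p).

Lemma toC_milnor_map z : toC (milnor_map f z) = F z / `|F z|.
Proof. exact: ofCK. Qed.

Lemma milnor_map_act z : toC (milnor_map f (A z)) = zeta ^+ k * toC (milnor_map f z).
Proof.
rewrite !toC_milnor_map zx_act zy_act f_equiv.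
by rewrite normrM normrX a1 expr1n mul1r mulrA.
Qed.

Lemma lens_milnor_proj z :
  lens_milnor (pi z) = ofC (toC (milnor_map f (set_val z)) ^+ p).
Proof.
have : pi z = pi (repr (pi z)) by rewrite /lens_proj reprK.
move/lens_projP => [n e]; rewrite /lens_milnor e; congr ofC.
have -> : toC (milnor_map f (iter n A (set_val z)))
    = (zeta ^+ k) ^+ n * toC (milnor_map f (set_val z)).
  elim: n {e} => [|n ih]; first by rewrite mul1r.
  by rewrite iterS milnor_map_act ih exprS mulrA.
by rewrite exprMn -!exprM mulnC exprM zp expr1n mul1r.
Qed.

Lemma power_continuous n : continuous (fun u : R * R => ofC (toC u ^+ n)).
Proof.
apply: ball_lipschitz_continuous.
elim: n => [|n ih]; first exact: complex_lipschitz_cst.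
have -> : (fun u : R * R => ofC (toC u ^+ n.+1))
    = (fun u => ofC (toC u * toC u ^+ n)) by apply/funext => u; rewrite exprS.
apply: complex_lipschitzM => // r; exists 1 => // u v _ _.
by rewrite !toCK mul1r.
Qed.

Lemma lens_milnor_continuous (z : TS) : F (set_val z) != 0 ->
  {for pi z, continuous lens_milnor}.
Proof.
move=> fz U; rewrite lens_milnor_proj => nU; apply: nbhs_lens_proj.
have fz' : polymap f (set_val z) != 0.
  by apply: contraNneq fz => h; rewrite -[eval2 _ _ _]ofCK -/(polymap f _) h.
have c1 : polymap f (set_val w) @[w --> z] --> polymap f (set_val z).
  exact: (cvg_comp _ _ (@set_val_continuous _ _ z) (@f_cont (set_val z))).
have c2 := differentiable_continuous (normalize_differentiable fz').
have c3 := cvg_comp _ _ c1 c2.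
have mE w : @normalize R (polymap f w) = milnor_map f w by rewrite milnor_mapE.
have c4 := cvg_comp _ _ c3 (@power_continuous p _).
have := c4 U; rewrite mE => /(_ nU) zU.
apply: (@filterS _ (nbhs z) _ _ _ _ zU) => w.
by rewrite /= lens_milnor_proj mE.
Qed.

Lemma lens_flow_zero t z : F (set_val z) != 0 -> F (set_val (flow_lift t z)) != 0.
Proof.
move=> fz; have [r r0 ->] := PhiF t (set_valP z) fz.
rewrite !mulf_neq0//; first by rewrite eq_complex /= eqxx andbT gt_eqF.
by rewrite -normr_eq0 norm_cis oner_neq0.
Qed.

Lemma milnor_map_flow t z : sphere3 eps z -> F z != 0 ->
  toC (milnor_map f (Phi t z)) = cis t * toC (milnor_map f z).
Proof.
move=> Sz fz; have [r r0 e] := PhiF t Sz fz; rewrite !toC_milnor_map e.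
have nr : `|r%:C| = r%:C :> R[i] by rewrite ger0_norm// ler0c ltW.
have r0' : r%:C != 0 :> R[i] by rewrite eq_complex /= eqxx andbT gt_eqF.
rewrite !normrM norm_cis mul1r nr invfM mulrACA divff// mul1r.
by rewrite -mulrA.
Qed.

Lemma lens_fiber_bundle : fiber_bundle (~` K) (@circle R) lens_milnor.
Proof.
have Kz z : (~` K) (pi z) <-> F (set_val z) != 0.
  by split=> [h|/eqP h]; [apply/eqP => h'; apply/h/lens_proj_zero|
    move=> /lens_proj_zero].
(* The [p]-th power turns the phase [p] times as fast, so time is divided by [p]. *)
apply: (@fiber_bundle_of_flow R L (~` K) lens_milnor
  (fun t c => lens_flow (t / p%:R) c)).
- have [z [Sz fz]] := complement_nonempty.
  exists (pi (exist (fun x => x \in sphere3 eps) z (mem_set Sz))).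
  exact/Kz.
- apply/subspace_continuousP => c; have [z ->] := lens_proj_surj c => /Kz fz.
  by apply: cvg_within_filter; exact: lens_milnor_continuous.
- move=> c; have [z ->] := lens_proj_surj c => /Kz fz.
  rewrite lens_milnor_proj /circle /= ofCK normrX ofCK.
  by rewrite normf_div normr_id divff ?expr1n// normr_eq0.
- move=> [t c].
  have ct : tc.1 / p%:R @[tc --> nbhs (t, c)] --> t / p%:R.
    by apply: cvgM; [exact: cvg_fst|exact: cvg_cst].
  have cc : tc.2 @[tc --> nbhs (t, c)] --> c by exact: cvg_snd.
  exact: (cvg_comp _ _ (cvg_pair ct cc) (@lens_flow_continuous (t / p%:R, c))).
- move=> t c; have [z ->] := lens_proj_surj c => /Kz fz.
  by rewrite lens_flow_proj; apply/Kz; exact: lens_flow_zero.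
- move=> t c; have [z ->] := lens_proj_surj c; rewrite !lens_flow_proj.
  congr (pi _); apply: val_inj; rewrite /= mulNr.
  exact: PhiNK.
- move=> t c; have [z ->] := lens_proj_surj c => /Kz fz.
  rewrite lens_flow_proj !lens_milnor_proj ofCK.
  rewrite [milnor_map f (set_val (flow_lift _ _))]/(milnor_map f (Phi _ (set_val z))).
  rewrite milnor_map_flow//; last exact: set_valP.
  rewrite exprMn cisXn [p%:R * _]mulrC divfK// pnatr_eq0 -lt0n.
  exact: p0.
Qed.

End Bundle.

End LensFlow.

Theorem corollary3p17 (R : realType) (p : nat) (q : int) (zeta : R[i])
    (hp : (1 <= p)%N) (hpq : coprimez p%:Z q) (hzeta : p.-primitive_root zeta)
    (eps : R) (K : set (lens_space q eps hzeta))
    (hK : algebraic_link K) :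
  fibered_link K.
Proof.
have [f [r0 [_ [k _ fE] [_ mr] /andP[e0 er] liftK]]] := hK.
have [tl nc [_ fib _]] := mr eps e0 er.
have [fx [fy fP]] := has_partials_poly f.
have p0 := prim_order_gt0 hzeta; have zp := prim_expr_order hzeta.
have a1 := norm_root_of_unity p0 zp.
have b1 : `|zeta ^ q| = 1.
  apply: (norm_root_of_unity p0).
  by rewrite exprnP exprzAC -(exprnP zeta p) zp exp1rz.
have dp z : sphere3 eps z -> 0 < denom (fun z => eval2 f (zx z) (zy z)) fx fy z.
  move=> Sz; apply: (denom_positive fP e0 Sz tl) => nz.
  by apply: nc; split.
have [Phi [Pc PN PS PF PA]] := milnor_flow fP dp.
have fA z : eval2 f (zx (act zeta (zeta ^ q) z)) (zy (act zeta (zeta ^ q) z))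
    = zeta ^+ k * eval2 f (zx z) (zy z).
  by rewrite zx_act zy_act fE.
have c1 : `|zeta ^+ k| = 1 by rewrite normrX a1 expr1n.
exists (lens_milnor f); apply: (lens_fiber_bundle fE _ liftK _ Pc PN PS PF).
- exact: (ball_lipschitz_continuous (partials_lip fP)).
(* Surjectivity of the Milnor fibration onto the circle provides a point of the sphere off the
   link. *)
- have : circle (1, 0 : R) by apply/circleP; rewrite /= expr1n expr0n addr0.
  by rewrite -fib => -[z [Sz /eqP fz] _]; exists z.
- exact: (PA _ _ _ a1 b1 c1 fA).
Qed.
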